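(* Let $n \geq 3$ be an integer. The pendant $3$-tree-connectivity of the $n$-dimensional augmented cube $AQ_n$ is $\tau_3(AQ_n) = 2n-3$.
   Context: All graphs are finite, simple and undirected. **Augmented cubes.** For $n \geq 1$, the $n$-dimensional augmented cube $AQ_n$ is the graph with vertex set $\{0,1\}^n$ (all binary $n$-tuples) defined recursively as follows. $AQ_1$ is the complete graph $K_2$ on vertex set $\{0,1\}$. For $n \geq 2$, $AQ_n$ is obtained from two copies of $AQ_{n-1}$, denoted $AQ^0_{n-1}$ and $AQ^1_{n-1}$, with vertex sets $V(AQ^0_{n-1}) = \{0x_1x_2\dots x_{n-1} : x_i \in \{0,1\}\}$ and $V(AQ^1_{n-1}) = \{1y_1y_2\dots y_{n-1} : y_i \in \{0,1\}\}$ (each copy has the edges of $AQ_{n-1}$ after prefixing the indicated bit), by adding $2^n$ edges between them: a vertex $0x_1\dots x_{n-1}$ of $AQ^0_{n-1}$ is joined to a vertex $1y_1\dots y_{n-1}$ of $AQ^1_{n-1}$ if and only if either (1) $x_i = y_i$ for all $1 \leq i \leq n-1$, or (2) $x_i = \overline{y_i} = 1-y_i$ for all $1 \leq i \leq n-1$. **Pendant tree-connectivity.** Let $G$ be a graph and let $S \subseteq V(G)$ with $|S| \geq 2$. An $S$-Steiner tree is a subgraph $T$ of $G$ that is a tree with $S \subseteq V(T)$. It is a pendant $S$-Steiner tree if every vertex of $S$ has degree exactly one in $T$. Two pendant $S$-Steiner trees $T$ and $T'$ are internally disjoint if $E(T) \cap E(T') = \emptyset$ and $V(T) \cap V(T')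 = S$. The local pendant tree-connectivity $\tau_G(S)$ is the maximum number of pairwise internally disjoint pendant $S$-Steiner trees in $G$. For an integer $k$ with $2 \leq k \leq |V(G)|$, the pendant $k$-tree-connectivity of $G$ is $$\tau_k(G) = \min\{\tau_G(S) : S \subseteq V(G),\ |S| = k\}.$$ *)

(* Defs.v *)
From mathcomp Require Import all_boot.

Set Implicit Arguments.
Unset Strict Implicit.
Unset Printing Implicit Defensive.

Record sgraph := SGraph {
  vertex :> finType;
  adj : rel vertex;
  adj_sym : symmetric adj;
  adj_irrefl : irreflexive adj }.

Definition edges (G : sgraph) : {set {set G}} :=
  [set [set u.1; u.2] | u : G * G & adj u.1 u.2].

(* The base case of the recursion is AQ_1; the value at n = 0 (one vertex, no
   edge) only serves to make the function total. The head of the tuple is the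
   prefixed bit. *)
Fixpoint augcube_adj (n : nat) : rel (n.-tuple bool) :=
  match n return rel (n.-tuple bool) with
  | 0 => fun _ _ => false
  | m.+1 =>
    match m return rel (m.-tuple bool) -> rel (m.+1.-tuple bool) with
    | 0 => fun _ x y => x != y
    | _.+1 => fun r x y =>
        let x' := [tuple of behead x] in
        let y' := [tuple of behead y] in
        if thead x == thead y then r x' y'
        else (x' == y') || (x' == map negb y' :> seq bool)
    end (@augcube_adj m)
  end.

Lemma augcube_adj_sym n : symmetric (@augcube_adj n).
Proof.
elim: n => [//|[|n] IHn] x y; first by rewrite /= eq_sym.
rewrite /= [thead y == _]eq_sym; case: ifP => _; first exact: IHn.
rewrite [[tuple of behead y] == _]eq_sym; congr (_ || _).
by apply/eqP/eqP => /= ->; rewrite (mapK negbK).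
Qed.

Lemma augcube_adj_irrefl n : irreflexive (@augcube_adj n).
Proof.
elim: n => [//|[|n] IHn] x; first by rewrite /= eqxx.
by rewrite /= eqxx; apply: IHn.
Qed.

Definition AQ (n : nat) : sgraph :=
  SGraph (@augcube_adj_sym n) (@augcube_adj_irrefl n).

Section PendantTrees.
Variable G : sgraph.

(* A pair (vertex set, edge set); it is a subgraph of G only under
   [is_subgraph] below. *)
Definition subgr : Type := ({set G} * {set {set G}})%type.

Implicit Types (H T : subgr) (S : {set G}).

Definition sverts H : {set G} := H.1.
Definition sedges H : {set {set G}} := H.2.

Definition is_subgraph H : bool :=
  (sedges H \subset edges G) && [forall e in sedges H, e \subset sverts H].

Definition sadj H : rel G := [rel x y | [set x; y] \in sedges H].

Definition sdeg H (x : G) : nat := #|[set e in sedges H | x \in e]|.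

Definition sconnected H : bool :=
  (sverts H != set0) &&
  [forall x in sverts H, forall y in sverts H, connect (sadj H) x y].

(* A cycle has no repeated vertex, so bounding its length by #|G| loses
   nothing; see [sacyclicP]. *)
Definition sacyclic H : bool :=
  [forall l : 'I_#|G|.+1, forall c : l.-tuple G,
    (2 < size c) ==> ~~ ucycleb (sadj H) c].

Lemma sacyclicP H :
  reflect (forall c : seq G, 2 < size c -> ~ ucycle (sadj H) c) (sacyclic H).
Proof.
apply: (iffP forallP) => [acH c c_gt2 /[dup] cyc /andP[_ Uc]|acH l].
  have szc : size c < #|G|.+1 by rewrite ltnS -(card_uniqP Uc) max_card.
  have /forallP/(_ (in_tuple c)) := acH (Ordinal szc).
  by rewrite c_gt2 /=; move/negP; apply.
by apply/forallP => c; apply/implyP => /acH/negP.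
Qed.

Definition is_tree H : bool := [&& is_subgraph H, sconnected H & sacyclic H].

Definition steiner_tree S T : bool := is_tree T && (S \subset sverts T).

Definition pendant_tree S T : bool :=
  steiner_tree S T && [forall x in S, sdeg T x == 1].

Definition int_disjoint S T T' : bool :=
  (sedges T :&: sedges T' == set0) && (sverts T :&: sverts T' == S).

Definition pendant_packing S (F : {set subgr}) : bool :=
  [forall T in F, pendant_tree S T] &&
  [forall T in F, forall T' in F, (T != T') ==> int_disjoint S T T'].

Definition local_pendant_conn S : nat :=
  \max_(F : {set subgr} | pendant_packing S F) #|F|.

(* minn has no neutral element on nat, so the minimum starts from the maximum
   of the same values; see [pendant_conn_le] and [pendant_conn_attained]. *)
Definition pendant_conn (k : nat) : nat :=
  let m := \max_(S : {set G} | #|S| == k) local_pendant_conn S in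
  \big[minn/m]_(S : {set G} | #|S| == k) local_pendant_conn S.

Lemma pendant_conn_le k S : #|S| = k -> pendant_conn k <= local_pendant_conn S.
Proof.
move/eqP=> Sk; rewrite /pendant_conn; set m := \max_(_ | _) _.
move: m (mem_index_enum S) => m.
elim: (index_enum _) => // S' r IHr; rewrite in_cons big_cons.
case/predU1P => [<-|/IHr le_r]; first by rewrite Sk geq_minl.
by case: ifP => // _; exact: leq_trans (geq_minr _ _) le_r.
Qed.

Lemma pendant_conn_attained k : k <= #|G| ->
  exists2 S : {set G}, #|S| = k & pendant_conn k = local_pendant_conn S.
Proof.
move=> kG; have [S0 S0k] : exists S0 : {set G}, #|S0| == k.
  have : 0 < #|[set A : {set G} | #|A| == k]|.
    by rewrite card_draws bin_gt0.
  by case/card_gt0P => S; rewrite inE => ?; exists S.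
pose K m := exists2 S : {set G}, #|S| = k & m = local_pendant_conn S.
rewrite /pendant_conn; apply: (big_ind K); last by move=> S /eqP; exists S.
  have gt0 : 0 < #|[pred S : {set G} | #|S| == k]| by apply/card_gt0P; exists S0.
  by have [S /eqP Sk ->] := eq_bigmax_cond local_pendant_conn gt0; exists S.
by move=> m1 m2 K1 K2; rewrite /minn; case: ifP.
Qed.

End PendantTrees.

(* Main.v *)
Require Import Defs.
From mathcomp Require Import all_boot.
From mathcomp Require Import zify.

Set Implicit Arguments.
Unset Strict Implicit.
Unset Printing Implicit Defensive.

(** Removing the terminals from a pendant [S]-Steiner tree leaves a connected set
of vertices that is adjacent to every terminal; conversely a spanning tree of
such a set, with one more edge to each terminal, is a pendant tree. Hence
[local_pendant_conn S] is at least [k] as soon as there are [k] disjoint such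
sets, called branches here ([packs], [packs_local]).

Upper bound. The graph is regular of degree [2n - 1]. If the terminals form a
triangle, the trees of a packing use distinct edges at [x], and none of them
leads to another terminal, since both ends of such an edge would be leaves; so
there are at most [2n - 3] trees ([local_pendant_triangle]).

Lower bound, by induction on the dimension. The next cube consists of two copies
of the present one, where each vertex is joined to its twin and to the opposite
of its twin in the other copy ([doubling]).

If the three terminals lie in one copy, the branches found there by induction
are completed by the two halves of the other copy: each of these is connected
and contains a twin of every vertex or the opposite of this twin
([packs_one_half]).

If [x] and [y] lie in one copy and [z] in the other, the induction hypothesis is
not used; the branches come from Menger's theorem ([packs_two_halves]). In the
copy of [x] and [y] take disjoint connected sets linking [x] to [y], in the other
copy a fan from [z] to the twins of vertices chosen in these sets, and glue. This
gives enough branches when [x] and [y] are not adjacent. When they are, one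
linking set is missing, and a last branch is made of the twins of [x] and [y] and
of one path of the fan, or of a common neighbour of all terminals ([packs_adjacent],
[packs_opposite]).

The connectedness needed by Menger's theorem is an isoperimetric inequality on
vertex boundaries, again proved by doubling ([boundary_connected_double]). It
fails in dimension 3, where the connectedness is 4 instead of 5. Dimension 4,
which the doubling step would derive from this one, is therefore settled by a
finite search ([cube3_search]); dimension 3 follows from the complete graph on
four vertices by the general step. *)

(** * Menger's theorem for disjoint sets linking two sets of vertices *)

Definition rin (T : finType) (r : rel T) (D : {set T}) : rel T :=
  [rel u v | [&& r u v, u \in D & v \in D]].

(** The two sides of a separation of [r], which overlap in its separator, are kept
as a pair: this form is symmetric in [A] and [B], and two separations are
combined by unions and intersections of their sides. *)
Definition separation (T : finType) (r : rel T) (A B : {set T})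
    (P : {set T} * {set T}) : bool :=
  [&& P.1 :|: P.2 == setT, A \subset P.1, B \subset P.2 &
      [forall u in ~: P.2, forall v in ~: P.1, ~~ r u v]].

Definition linkage (T : finType) (r : rel T) (A B : {set T}) k
    (C : 'I_k -> {set T}) : Prop :=
  (forall i j, i != j -> [disjoint C i & C j]) /\
  (forall i, exists a b, [/\ a \in A :&: C i, b \in B :&: C i
                           & connect (rin r (C i)) a b]).

Lemma separationP (T : finType) (r : rel T) (A B U W : {set T}) :
  reflect [/\ forall v, v \notin W -> v \in U, A \subset U, B \subset W &
              forall u v, u \notin W -> r u v -> v \in U]
          (separation r A B (U, W)).
Proof.
apply: (iffP and4P) => /= [[/eqP UW AU BW /forall_inP sep]|[UW AU BW sep]]; split=> //.
- by move=> v vW; move: (in_setT v); rewrite -UW inE (negPf vW) orbF.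
- move=> u v uW; apply: contraTT => vU.
  have := sep u; rewrite inE => /(_ uW)/forall_inP/(_ v); rewrite inE => H.
  exact: H.
- by apply/eqP/setP=> v; rewrite !inE; case: (boolP (v \in W)) => [|/UW ->]; rewrite ?orbT.
- apply/forall_inP => u; rewrite inE => uW; apply/forall_inP => v; rewrite inE.
  by apply: contra => /(sep _ _ uW).
Qed.

Lemma connect_mono (T : finType) (r r' : rel T) :
  subrel r r' -> subrel (connect r) (connect r').
Proof. by move=> rr'; apply: connect_sub => x y /rr'/connect1. Qed.

(** The choice [p] of one vertex of [P] in each set is injective, hence onto [P]
because there are at least as many sets as vertices of [P]. *)
Lemma transversal_exact (T : finType) k (C : 'I_k -> {set T}) (P : {set T})
    (p : 'I_k -> T) :
  (forall i j, i != j -> [disjoint C i & C j]) ->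
  (forall i, p i \in P :&: C i) -> #|P| <= k ->
  (forall v, v \in P -> exists i, v = p i) /\
  (forall i v, v \in P -> v \in C i -> v = p i).
Proof.
move=> dC pP leP.
have pinj : injective p.
  move=> i j pij; apply/eqP; apply: contraT => /dC/disjointFr/(_ _)E.
  have := pP i; rewrite inE => /andP[_ /E]; rewrite pij.
  by have := pP j; rewrite inE => /andP[_ ->].
have imP : P \subset p @: 'I_k.
  have sub : p @: 'I_k \subset P.
    by apply/subsetP => _ /imsetP[i _ ->]; have := pP i; rewrite inE => /andP[].
  suff /eqP -> : p @: 'I_k == P by [].
  by rewrite eqEcard sub card_imset // card_ord.
have surj v : v \in P -> exists i, v = p i.
  by move/(subsetP imP)/imsetP => [i _ ->]; exists i.
split=> // i v /surj[j ->] pC; congr p; apply/eqP; apply: contraT => /dC/disjointFr E.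
by have := pP j; rewrite inE => /andP[_ /E]; rewrite pC.
Qed.

(** Göring's argument, by deletion of one arc [x -> y]. If the smaller relation
has a separation [(U, W)] of order less than [k], that arc must cross it, so
that both [U :&: W] plus [x] and [U :&: W] plus [y] have exactly [k] elements.
By induction there are [k] sets linking [A] to the former inside [U] and [k]
sets linking the latter to [B] inside [W]; they are glued along [U :&: W] and
along the deleted arc. *)
Lemma menger (T : finType) k (r : rel T) (A B : {set T}) :
  (forall P, separation r A B P -> k <= #|P.1 :&: P.2|) ->
  exists C : 'I_k -> {set T}, linkage r A B C.
Proof.
have [N] := ubnP #|[set a : T * T | r a.1 a.2]|.
elim: N r A B => // N IH r A B; rewrite ltnS => leN sepk.
have [a0|[[x y] rxy]] := set_0Vmem [set a : T * T | r a.1 a.2].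
  have leAB : k <= #|A :&: B|.
    have -> : A :&: B = A :&: ~: (A :\: B).
      by apply/setP=> v; rewrite !inE; case: (v \in A); rewrite ?andbF ?andbT ?negbK.
    apply: (sepk (A, ~: (A :\: B))); apply/separationP; split=> //.
    - by move=> v; rewrite !inE negbK => /andP[].
    - by apply/subsetP=> v; rewrite !inE => ->.
    by move=> u v _ ruv; have := in_set0 (u, v); rewrite -a0 inE /= ruv.
  have kc i : nat_of_ord i < #|A :&: B| := leq_trans (ltn_ord i) leAB.
  exists (fun i : 'I_k => [set enum_val (Ordinal (kc i))]); split=> [i j ij|i].
    rewrite disjoints1 inE (inj_eq enum_val_inj).
    by apply: contra ij => /eqP[/val_inj ->].
  have := enum_valP (Ordinal (kc i)); set v := enum_val _ => vAB.
  exists v, v; rewrite connect0 !inE eqxx !andbT.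
  by move: vAB; rewrite inE => /andP[].
rewrite inE /= in rxy.
pose r' := [rel u v | r u v && ((u, v) != (x, y))].
have r'r : subrel r' r by move=> u v /andP[].
have lt_arcs (s : rel T) : subrel s r' -> #|[set a | s a.1 a.2]| < N.
  move=> sr'; apply: leq_trans leN; apply/proper_card/properP; split.
    by apply/subsetP=> a; rewrite !inE => /sr'/r'r.
  by exists (x, y); rewrite !inE //=; apply/negP => /sr' /andP[_ /eqP].
have [[U W] /= /andP[sepUW ltUW]|nosep] :=
    pickP (fun P => separation r' A B P && (#|P.1 :&: P.2| < k)); last first.
  have [|C [dC lC]] := IH r' A B (lt_arcs _ (fun _ _ => id)).
    by move=> P sepP; have := nosep P; rewrite sepP => /negbT; rewrite -leqNgt.
  exists C; split=> // i; have [a [b [aC bC cab]]] := lC i; exists a, b; split=> //.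
  by apply: connect_mono cab => u v /and3P[/r'r ? ? ?]; apply/and3P.
case/separationP: sepUW => UW AU BW noarc.
(* Every arc of [r] from outside [W] to outside [U] is the deleted one. *)
have cross u v : u \notin W -> r u v -> v \notin U -> u = x /\ v = y.
  move=> uW ruv; case: (eqVneq (u, v) (x, y)) => [[-> ->] //|ne].
  by rewrite (noarc u) //= ruv.
have [xW yU] : x \notin W /\ y \notin U.
  have : ~~ separation r A B (U, W).
    by apply: contraL ltUW => /sepk; rewrite -leqNgt.
  have [|yU] := boolP ((x \notin W) && (y \notin U)); first by case/andP.
  case/separationP; split=> // u v uW ruv; apply: contraT => vU.
  by have [ux vy] := cross u v uW ruv vU; rewrite -ux uW -vy vU in yU.
have xU := UW _ xW; have yW : y \in W by apply: contraR yU => /UW.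
pose S := U :&: W; pose P := x |: S; pose Q := y |: S.
have SP : S \subset P by apply: subsetUr.
have SQ : S \subset Q by apply: subsetUr.
have leP : #|P| <= k by rewrite cardsU1 !inE negb_and xW orbT.
have leQ : #|Q| <= k by rewrite cardsU1 !inE negb_and yU.
pose rU := rin r' U; pose rW := rin r' W.
(* Any separation of [A] and [P] is cut down by [(U, W)] to one of [A] and [B] in
   [r], without enlarging its separator. *)
have subU : subrel rU r' by move=> u v /and3P[].
have [|C [dC lC]] := IH rU A P (lt_arcs _ subU).
  case=> U1 W1 /separationP[UW1 AU1 PW1 no1] /=.
  have /sepk /leq_trans -> //= : separation r A B (U :&: U1, W :|: W1).
    apply/separationP; split; last 1 first.
    + move=> u v; rewrite !inE negb_or => /andP[uW uW1] ruv.
      have ux : u != x by apply: contraNneq uW1 => ->; rewrite (subsetP PW1) ?setU11.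
      have vU : v \in U.
        by apply: contraT => /(cross _ _ uW ruv)[ux']; rewrite ux' eqxx in ux.
      rewrite vU (no1 u) //; apply/and3P; split=> //; last exact: UW.
      rewrite /r' /= ruv.
      by apply: contraNneq ux => -[->].
    + by move=> v; rewrite !inE negb_or => /andP[/UW -> /UW1 ->].
    + by rewrite subsetI AU.
    + by rewrite (subset_trans BW) ?subsetUl.
  apply/subset_leq_card/subsetP=> v; rewrite !inE.
  case/andP=> /andP[vU vU1] /orP[vW|->]; rewrite vU1 //.
  by rewrite (subsetP PW1) // (subsetP SP) // inE vU.
have subW : subrel rW r' by move=> u v /and3P[].
have [|D [dD lD]] := IH rW Q B (lt_arcs _ subW).
  case=> U2 W2 /separationP[UW2 QU2 BW2 no2] /=.
  have /sepk /leq_trans -> //= : separation r A B (U :|: U2, W :&: W2).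
    apply/separationP; split; last 1 first.
    + move=> u v; rewrite !inE => uW ruv; apply: contraT; rewrite negb_or.
      case/andP=> vU vU2.
      have vy : v != y by apply: contraNneq vU2 => ->; rewrite (subsetP QU2) ?setU11.
      have vW : v \in W by apply: contraR vU => /UW.
      have uWT : u \in W.
        by apply: contraT => uW'; have [_ /eqP] := cross _ _ uW' ruv vU; rewrite (negPf vy).
      rewrite uWT /= in uW; have /negP[] := vU2; apply: (no2 u) => //.
      apply/and3P; split=> //; rewrite /r' /= ruv.
      by apply: contraNneq vy => -[_ ->].
    + move=> v; rewrite !inE negb_and => /orP[/UW -> //|/UW2 ->]; exact: orbT.
    + by rewrite (subset_trans AU) ?subsetUl.
    + by rewrite subsetI BW.
  apply/subset_leq_card/subsetP=> v; rewrite !inE.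
  case/andP=> /orP[vU|->] /andP[vW vW2]; rewrite vW2 // andbT.
  by rewrite (subsetP QU2) // (subsetP SQ) // inE vU.
have /fin_all_exists2[a aC /fin_all_exists2[p pC cC]] i :
    exists2 a, a \in A :&: C i & exists2 p, p \in P :&: C i & connect (rin rU (C i)) a p.
  by have [a [p []]] := lC i; exists a => //; exists p.
have /fin_all_exists2[q qD /fin_all_exists2[b bD cD]] j :
    exists2 q, q \in Q :&: D j & exists2 b, b \in B :&: D j & connect (rin rW (D j)) q b.
  by have [q [b []]] := lD j; exists q => //; exists b.
(* The [C i] and [D j] that end at the same vertex of [S], or at [x] and [y], are
   glued; their traces on [U] and [W] meet nowhere else. *)
have [_ exP] := transversal_exact dC pC leP.
have [surjQ exQ] := transversal_exact dD qD leQ.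
pose swap v := if v == x then y else v.
have /fin_all_exists[mu muE] i : exists j, swap (p i) = q j.
  apply: surjQ; rewrite /swap !inE; have := pC i; rewrite !inE => /andP[+ _].
  by case: eqVneq => [_ _|_ /= /andP[-> ->]]; rewrite ?eqxx ?orbT.
have pU i : p i \in U.
  by have := pC i; rewrite !inE => /andP[/orP[/eqP ->|/andP[]] //].
have qW j : q j \in W.
  by have := qD j; rewrite !inE => /andP[/orP[/eqP ->|/andP[]] //].
have swap_inj i j : swap (p i) = swap (p j) -> i = j.
  have Uy l : (p l == y) = false by apply: contraNF yU => /eqP <-.
  move=> E; have pij : p i = p j.
    move: E; rewrite /swap; case: eqVneq => [->|_]; case: eqVneq => // _ /eqP.
      by rewrite eq_sym Uy.
    by rewrite Uy.
  apply/eqP; apply: contraT => /dC/disjointFr E'.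
  have := pC i; rewrite inE => /andP[_ /E']; rewrite pij.
  by have := pC j; rewrite inE => /andP[_ ->].
have glue i j v : v \in C i -> v \in U -> v \in D (mu j) -> v \in W -> i = j.
  move=> vC vU vD vW; have vS : v \in S by rewrite inE vU.
  have vp := exP i v (subsetP SP v vS) vC; have vq := exQ _ v (subsetP SQ v vS) vD.
  apply: swap_inj; rewrite (muE j) -vq {1}/swap -vp.
  by case: eqVneq vW => // ->; rewrite (negPf xW).
exists (fun i => (C i :&: U) :|: (D (mu i) :&: W)); split=> [i j ij|i].
  rewrite -setI_eq0; apply/eqP/setP => v; rewrite !inE; apply/negP.
  case/andP=> /orP[] /andP[v1 v2] /orP[] /andP[v3 v4].
  - by rewrite (disjointFr (dC _ _ ij) v1) in v3.
  - by move: ij; rewrite (glue i j v) // eqxx.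
  - by move: ij; rewrite (glue j i v) // eqxx.
  have ne : mu i != mu j.
    by apply: contra ij => /eqP E; apply/eqP/swap_inj; rewrite !muE E.
  by rewrite (disjointFr (dD _ _ ne) v1) in v3.
have := aC i; have := bD (mu i); have := pC i; have := qD (mu i).
rewrite !in_setI => /andP[_ qDi] /andP[_ pCi] /andP[bB bDi] /andP[aA aCi].
exists (a i), (b (mu i)); rewrite !inE aA bB aCi bDi (subsetP AU _ aA) (subsetP BW _ bB) ?orbT //=.
split=> //; apply: (@connect_trans _ _ (p i)).
  apply: connect_mono (cC i) => u v /and3P[/and3P[/r'r ? ? ?] ? ?].
  by apply/and3P; split=> //; rewrite !inE; apply/orP; left; apply/andP.
apply: (@connect_trans _ _ (q (mu i))); last first.
  apply: connect_mono (cD (mu i)) => u v /and3P[/and3P[/r'r ? ? ?] ? ?].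
  by apply/and3P; split=> //; rewrite !inE; apply/orP; right; apply/andP.
have := pU i; have := qW (mu i); have := muE i; rewrite /swap.
case: eqVneq => [px qy qW' pU'|_ -> //]; apply: connect1.
by apply/and3P; rewrite !inE pCi pU' qDi qW' orbT -qy px.
Qed.

(** * Connected sets of vertices *)

Lemma disjoint_setU (T : finType) (A B C : {set T}) :
  [disjoint A :|: B & C] = [disjoint A & C] && [disjoint B & C].
Proof. by rewrite !disjoints_subset subUset. Qed.

Definition connected_in (T : finType) (e : rel T) (C : {set T}) : Prop :=
  C != set0 /\ forall u v, u \in C -> v \in C -> connect (rin e C) u v.

Section Connected.
Variables (T : finType) (e : rel T).
Hypothesis e_sym : symmetric e.

Lemma rin_connect_sym (D : {set T}) u v :
  connect (rin e D) u v = connect (rin e D) v u.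
Proof. by apply: sym_connect_sym => a b; rewrite /rin /= e_sym [(a \in D) && _]andbC. Qed.

Lemma connect_subset (C D : {set T}) u v :
  C \subset D -> connect (rin e C) u v -> connect (rin e D) u v.
Proof.
move=> /subsetP CD; apply: connect_mono => a b /and3P[? /CD ? /CD ?].
exact/and3P.
Qed.

Lemma connected_root a (C : {set T}) :
  a \in C -> (forall v, v \in C -> connect (rin e C) a v) -> connected_in e C.
Proof.
move=> aC toC; split=> [|u v uC vC]; first by apply/set0Pn; exists a.
by apply: connect_trans (toC _ vC); rewrite rin_connect_sym toC.
Qed.

Lemma connected_set1 a : connected_in e [set a].
Proof.
apply: (@connected_root a) => [|v]; first exact: set11.
by move/set1P->.
Qed.

Lemma connectedU u v (C D : {set T}) :
  connected_in e C -> connected_in e D -> u \in C -> v \in D -> e u v ->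
  connected_in e (C :|: D).
Proof.
move=> [_ cC] [_ cD] uC vD euv; apply: (@connected_root u) => [|w].
  by rewrite inE uC.
rewrite inE => /orP[wC|wD].
  by apply: connect_subset (cC _ _ uC wC); apply: subsetUl.
apply: (@connect_trans _ _ v); last first.
  by apply: connect_subset (cD _ _ vD wD); apply: subsetUr.
by apply/connect1/and3P; rewrite euv !inE uC vD orbT.
Qed.

Lemma component_connected (X : {set T}) a :
  let K := [set v | connect (rin e X) a v] in
  a \in X -> [/\ connected_in e K, a \in K, K \subset X &
    forall u v, u \in K -> v \in X -> e u v -> v \in K].
Proof.
move=> K aX; have aK : a \in K by rewrite inE.
have KX : K \subset X.
  apply/subsetP => v; rewrite inE => av.
  have clX : closed (rin e X) (mem X) by move=> u w /and3P[_ uX wX] /=; rewrite uX wX.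
  by have /= <- := closed_connect clX av.
have step u v : u \in K -> v \in X -> e u v -> v \in K.
  move=> uK vX euv; have uX := subsetP KX u uK; move: uK; rewrite !inE => uK.
  by apply: connect_trans uK _; apply/connect1/and3P.
split=> //; apply: (connected_root aK) => v; rewrite inE => /connectP[p].
elim/last_ind: p v => [|p w IHp] v /=; first by move=> _ ->; apply: connect0.
rewrite rcons_path last_rcons => /andP[ep ew] ->.
have lK : last a p \in K by rewrite inE; apply/connectP; exists p.
have [ew' _ wX] := and3P ew.
apply: connect_trans (IHp _ ep erefl) _; apply/connect1/and3P; split=> //.
exact: step ew'.
Qed.

End Connected.

Lemma connected_imset (T T' : finType) (e : rel T) (e' : rel T') (h : T -> T')
    (C : {set T}) : (forall u v, e u v -> e' (h u) (h v)) ->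
  connected_in e C -> connected_in e' (h @: C).
Proof.
move=> hom [/set0Pn[a aC] cC]; split; first by apply/set0Pn; exists (h a); rewrite imset_f.
move=> _ _ /imsetP[u uC ->] /imsetP[v vC ->].
have /connectP[p pth ->] := cC u v uC vC.
apply/connectP; exists (map h p); last by rewrite last_map.
elim: p u {uC v vC} pth => //= w p IHp u /andP[/and3P[euw uC wC] /IHp ->].
by rewrite andbT; apply/and3P; split; [exact: hom | exact: imset_f..].
Qed.

(** * Vertex boundaries and fans *)

Definition boundary (T : finType) (e : rel T) (A : {set T}) : {set T} :=
  [set v in ~: A | [exists u in A, e u v]].

(** This is [k]-connectedness read off the vertex boundaries: a set of vertices
that does not dominate the graph is cut off from the rest by its boundary.
A complete graph satisfies it for every [k]. *)
Definition boundary_connected (T : finType) (e : rel T) k : Prop :=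
  forall A : {set T}, A != set0 -> A :|: boundary e A != setT ->
  k <= #|boundary e A|.

Section Fans.
Variables (T : finType) (e : rel T) (k : nat).
Hypothesis e_sym : symmetric e.
Hypothesis conn : boundary_connected e k.

(** A linkage inside [D] for a symmetric relation, where each linking set is cut
down to a connected component. *)
Lemma menger_connected j (D A B : {set T}) : A \subset D -> B \subset D ->
  (forall P, separation (rin e D) A B P -> j <= #|P.1 :&: P.2|) ->
  exists C : 'I_j -> {set T}, [/\ forall i i', i != i' -> [disjoint C i & C i']
    & forall i, [/\ connected_in e (C i), C i \subset D,
                    exists a, a \in A :&: C i & exists b, b \in B :&: C i]].
Proof.
move=> AD BD /menger[C [dC lC]].
have /fin_all_exists[K KP] i : exists K : {set T}, K \subset C i /\
    [/\ connected_in e K, K \subset D,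
        exists a, a \in A :&: K & exists b, b \in B :&: K].
  have [a [b [aA bB ab]]] := lC i.
  move: aA bB; rewrite !in_setI => /andP[aA aC] /andP[bB bC].
  have aX : a \in C i :&: D by rewrite inE aC (subsetP AD).
  have [cK aK KX _] := component_connected e_sym aX.
  exists [set v | connect (rin e (C i :&: D)) a v].
  move: KX; rewrite subsetI => /andP[KC KD]; do 2!split=> //.
    by exists a; rewrite inE aA.
  exists b; rewrite !inE bB; apply: connect_mono ab => u v.
  by case/and3P=> /and3P[? ? ?] ? ?; apply/and3P; rewrite !inE; split=> //; apply/andP.
exists K; split=> [i i' ne|i]; last by case: (KP i).
have [[KC _] [KC' _]] := (KP i, KP i').
exact: disjointWl KC (disjointWr KC' (dC _ _ ne)).
Qed.

(** Sets of [T] fanning out from [z] to [B] and avoiding [Y]. A separation of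
smaller order yields a set around [z] whose boundary lies in the separator
together with [Y]; the vertices of [Y] whose only neighbours are in [B] cannot
belong to this boundary, so only the others, [Y'], have to be counted. *)
Lemma fan_sets j z (Y Y' B : {set T}) :
  Y' \subset Y -> B \subset ~: (z |: Y) -> j <= #|B| -> j + #|Y'| <= k ->
  (forall y u, y \in Y :\: Y' -> e y u -> u \in B) ->
  exists C : 'I_j -> {set T}, [/\ forall i i', i != i' -> [disjoint C i & C i']
    & forall i, [/\ connected_in e (C i), C i \subset ~: (z |: Y),
                    exists2 a, a \in C i & e z a & exists b, b \in B :&: C i]].
Proof.
move=> YY BD leB lek nbrY; set D := ~: (z |: Y).
have [||[U W] sep|C [dC CP]] := @menger_connected j D [set u in D | e z u] B.
- by apply/subsetP=> u; rewrite inE => /andP[].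
- exact: BD.
- case/separationP: sep => UW AU BW sep /=.
  pose R := z |: (D :&: ~: W).
  have sub : boundary e R \subset (U :&: W) :|: Y'.
    apply/subsetP => v; rewrite inE in_setC in_setU1 in_setI in_setC.
    rewrite in_setU in_setI negb_or negb_and negbK.
    case/andP=> /andP[vz vDW] /exists_inP[u uR euv].
    have [vY'|vY'] := boolP (v \in Y'); rewrite ?orbT ?orbF //.
    have vD : v \in D.
      rewrite !inE negb_or vz /=; apply/negP=> vY.
      have uB : u \in B by apply: (nbrY v); rewrite ?inE ?vY' // e_sym.
      move: uR; rewrite !inE (subsetP BW _ uB) andbF orbF => /eqP uz.
      by have := subsetP BD _ uB; rewrite uz !inE eqxx.
    have vW : v \in W by move: vDW; rewrite vD.
    rewrite vW andbT; move: uR; rewrite !inE => /orP[/eqP uz|/andP[uD uW]].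
      by rewrite (subsetP AU) // inE vD -uz.
    by apply: (sep u) => //; apply/and3P; split=> //; rewrite !inE.
  have [RT|/conn le] := eqVneq (R :|: boundary e R) setT.
    apply/(leq_trans leB)/subset_leq_card/subsetP=> b bB.
    have /(subsetP BD) := bB; rewrite inE => /[dup] bD; rewrite !inE negb_or => /andP[bz bY].
    have : b \in R :|: boundary e R by rewrite RT inE.
    rewrite inE => /orP[|/(subsetP sub)].
      by rewrite !inE (negPf bz) (subsetP BW _ bB) andbF.
    by rewrite !inE => /orP[//|/(subsetP YY)]; rewrite (negPf bY).
  rewrite -(leq_add2r #|Y'|); apply: (leq_trans lek); apply: leq_trans (le _) _.
    by apply/set0Pn; exists z; rewrite setU11.
  exact: leq_trans (subset_leq_card sub) (leq_card_setU _ _).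
exists C; split=> // i; have [cC CD [a aA] bB] := CP i; split=> //.
by move: aA; rewrite !inE => /andP[/andP[_ ea] aC]; exists a.
Qed.

(** Here the members of the fan are indexed by their targets; the one for the
target [z], if any, is empty. *)
Lemma fan z (Y B : {set T}) :
  B \subset ~: Y -> #|B :\ z| + #|Y| <= k ->
  exists F : T -> {set T}, [/\ F z = set0,
    forall u, u \in B -> u != z ->
      [/\ connected_in e (F u), u \in F u, F u \subset ~: (z |: Y)
        & exists2 a, a \in F u & e z a]
    & forall u v, u \in B -> v \in B -> u != v -> [disjoint F u & F v]].
Proof.
move=> BY lek.
have [||||y u|C [dC CP]] := @fan_sets #|B :\ z| z Y Y (B :\ z).
- exact: subxx.
- apply/subsetP=> v; rewrite !inE negb_or => /andP[-> vB] /=.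
  by have := subsetP BY _ vB; rewrite inE.
- exact: leqnn.
- exact: lek.
- by rewrite setDv inE.
have /fin_all_exists[b bC] i : exists b, b \in (B :\ z) :&: C i.
  by have [_ _ _] := CP i.
have [surj _] := transversal_exact dC bC (leqnn _).
have /fin_all_exists[F FP] u : exists X : {set T}, [/\ u = z -> X = set0 &
    u \in B :\ z -> exists2 i, u = b i & X = C i].
  have [->|uz] := eqVneq u z; first by exists set0; split=> //; rewrite !inE eqxx.
  have [/surj[i ui]|uB] := boolP (u \in B :\ z); last by exists set0.
  by exists (C i); split=> [/eqP|_]; [rewrite (negPf uz) | exists i].
have Fz : F z = set0 by case: (FP z) => ->.
have FB u : u \in B -> u != z -> exists2 i, u = b i & F u = C i.
  by move=> uB uz; case: (FP u) => _; apply; rewrite !inE uz.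
exists F; split=> // [u uB uz|u v uB vB uv].
  have [i ub ->] := FB u uB uz; have [? ? ? _] := CP i; split=> //.
  by have := bC i; rewrite -ub inE => /andP[].
have [->|uz] := eqVneq u z; first by rewrite Fz disjoints_subset sub0set.
have [->|vz] := eqVneq v z; first by rewrite Fz disjoint_sym disjoints_subset sub0set.
have [i ub ->] := FB u uB uz; have [i' vb ->] := FB v vB vz.
by apply: dC; apply: contra uv => /eqP ii; rewrite ub vb ii.
Qed.

Hypothesis deg : forall v, k <= #|[set u | e v u]|.
Hypothesis e_irr : irreflexive e.

(** Fans from [x] to the neighbours of [y], which avoid [y]. The vertex [y] can
lie in a boundary around [x] only if it is adjacent to [x]: this is where one
set is lost. *)
Lemma linking_sets x y : 0 < k -> x != y ->
  exists C : 'I_(k - e x y) -> {set T}, [/\ forall i i', i != i' -> [disjoint C i & C i']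
    & forall i, [/\ connected_in e (C i), C i \subset ~: [set x; y],
                    exists2 a, a \in C i & e x a & exists2 b, b \in C i & e y b]].
Proof.
move=> k_gt0 xy; pose Y' := if e x y then [set y] else set0.
have [|||||C [dC CP]] := @fan_sets (k - e x y) x [set y] Y' ([set u | e y u] :\ x).
- by rewrite /Y'; case: ifP; rewrite ?sub0set.
- apply/subsetP=> v; rewrite !inE negb_or => /andP[-> yv] /=.
  by apply: contraTneq yv => ->; rewrite e_irr.
- rewrite leq_subLR (leq_trans (deg y)) // (cardsD1 x) inE e_sym.
  by rewrite leq_add2r; case: (e x y).
- rewrite /Y'; case: ifP => exy; rewrite ?cards1 ?cards0 ?addn0 ?subnK ?subn0 //.
- move=> v u; rewrite /Y'; case: ifP => exy; rewrite !inE; first by case: eqP.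
  move=> /eqP -> yu; rewrite yu andbT.
  by apply: contraFneq exy => <-; rewrite e_sym.
exists C; split=> // i; have [cC CD ? [b]] := CP i; rewrite !inE.
by case/andP=> /andP[_ yb] bC; split=> //; exists b.
Qed.

(** A vertex missed by a family of connected sets lies in a component of the
remaining vertices; this component is adjacent to one of the sets, for otherwise
its boundary would be within [[set x; y]]. *)
Lemma absorb j x y t (C : 'I_j -> {set T}) :
  2 < k -> 0 < j -> t \notin [set x; y] ->
  (forall i i', i != i' -> [disjoint C i & C i']) ->
  (forall i, connected_in e (C i) /\ C i \subset ~: [set x; y]) ->
  exists C' : 'I_j -> {set T},
    [/\ forall i i', i != i' -> [disjoint C' i & C' i'],
        forall i, [/\ connected_in e (C' i), C' i \subset ~: [set x; y] & C i \subset C' i]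
      & exists i, t \in C' i].
Proof.
move=> k2 j0 txy dC CP.
have [/existsP[i ti]|noC] := boolP [exists i, t \in C i].
  by exists C; split=> // [i'|]; [case: (CP i') | exists i].
pose X := ~: ([set x; y] :|: \bigcup_i C i).
have tX : t \in X.
  rewrite !inE negb_or; move: txy; rewrite !inE => -> /=.
  by apply: contra noC => /bigcupP[i _ ti]; apply/existsP; exists i.
have [cK tK KX clK] := component_connected e_sym tX.
set K := [set v | _] in cK tK KX clK.
have KC i : [disjoint K & C i].
  rewrite disjoints_subset (subset_trans KX) // setCS.
  by apply: subset_trans (subsetUr _ _); apply: bigcup_sup.
have Kxy : K \subset ~: [set x; y] by rewrite (subset_trans KX) // setCS subsetUl.
have [/existsP[i /exists_inP[u uK /exists_inP[v vC euv]]]|noadj] :=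
    boolP [exists i, [exists u in K, [exists v in C i, e u v]]].
  exists (fun i' => if i' == i then C i' :|: K else C i'); split=> [i1 i2 ne|i'|].
  - have [E1|_] := eqVneq i1 i; have [E2|_] := eqVneq i2 i; last exact: dC.
    + by rewrite E1 E2 eqxx in ne.
    + by rewrite disjoint_setU dC // KC.
    by rewrite disjoint_sym disjoint_setU KC dC // eq_sym.
  - have [cC Cxy] := CP i'; have [E|_] := eqVneq i' i; last by split.
    split; [|by rewrite subUset Cxy|by rewrite subsetUl].
    by rewrite setUC; apply: (connectedU e_sym cK cC uK _ euv); rewrite E.
  by exists i; rewrite eqxx inE tK orbT.
pose i0 := Ordinal j0; have [[/set0Pn[a aC] _] Cxy] := CP i0.
have aK : a \notin K by rewrite (disjointFl (KC i0)).
have Kbd : boundary e K \subset [set x; y].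
  apply/subsetP=> v; rewrite inE in_setC => /andP[vK /exists_inP[u uK euv]].
  apply: contraR vK => vxy; apply: (clK u) => //; rewrite in_setC in_setU (negPf vxy) /=.
  apply: contra noadj => /bigcupP[i _ vC]; apply/existsP; exists i.
  by apply/exists_inP; exists u => //; apply/exists_inP; exists v.
have K0 : K != set0 by apply/set0Pn; exists t.
have /(conn K0) : K :|: boundary e K != setT.
  apply: contraTneq (in_setT a) => <-; rewrite in_setU negb_or aK.
  by apply/negP => /(subsetP Kbd); apply/negP; have := subsetP Cxy a aC; rewrite in_setC.
by rewrite leqNgt (leq_ltn_trans _ k2) // (leq_trans (subset_leq_card Kbd)) // cards2; case: eqP.
Qed.

End Fans.

(** * Families of branches *)

(** The non-terminal part of a pendant [S]-Steiner tree: a spanning tree of a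
branch, with one further edge to each vertex of [S], is such a tree. *)
Definition branch (T : finType) (e : rel T) (S C : {set T}) : Prop :=
  [/\ connected_in e C, C \subset ~: S & forall s, s \in S -> exists2 u, u \in C & e s u].

Definition branches (T : finType) (e : rel T) (S : {set T}) (I : finType)
    (C : I -> {set T}) : Prop :=
  (forall i, branch e S (C i)) /\ (forall i j, i != j -> [disjoint C i & C j]).

Definition packs (T : finType) (e : rel T) (S : {set T}) k : Prop :=
  exists C : 'I_k -> {set T}, branches e S C.

Lemma branches_packs (T : finType) (e : rel T) (S : {set T}) (I : finType)
    (C : I -> {set T}) k : branches e S C -> #|I| = k -> packs e S k.
Proof.
move=> [bC dC] <-; exists (fun i => C (enum_val i)); split=> [i|i j ij].
  exact: bC.
by apply: dC; rewrite (inj_eq enum_val_inj).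
Qed.

Lemma branches_add (T : finType) (e : rel T) (S : {set T}) (I : finType)
    (C : I -> {set T}) (L : {set T}) :
  branches e S C -> branch e S L -> (forall i, [disjoint L & C i]) ->
  packs e S #|I|.+1.
Proof.
move=> [bC dC] bL dL.
apply: (@branches_packs _ _ _ (option I) (fun o => if o is Some i then C i else L)).
  split=> [[i|] //|[i|] [j|] //= ij]; first by apply: dC; apply: contra ij => /eqP ->.
  by rewrite disjoint_sym.
by rewrite card_option.
Qed.

Lemma packs_iso (T T' : finType) (e : rel T) (e' : rel T') (h : T -> T')
    (S : {set T}) k : injective h -> (forall u v, e' (h u) (h v) = e u v) ->
  packs e S k -> packs e' (h @: S) k.
Proof.
move=> h_inj he [C [bC dC]]; exists (fun i => h @: C i); split=> [i|i j /dC].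
  have [cC CS adC] := bC i; split.
  - by apply: connected_imset cC => u v; rewrite he.
  - apply/subsetP=> _ /imsetP[u uC ->]; rewrite inE mem_imset //.
    by have := subsetP CS u uC; rewrite inE.
  move=> _ /imsetP[s sS ->]; have [u uC su] := adC s sS.
  by exists (h u); rewrite ?imset_f ?he.
by rewrite imset_disjoint.
Qed.

(** * Doubling a graph along an involution *)

(** Two copies of a graph, each vertex being joined to its twin and to the
opposite [c] of its twin: the recursive step of augmented cubes. *)
Definition doubling (T : eqType) (e : rel T) (c : T -> T) : rel (bool * T) :=
  [rel p q | if p.1 == q.1 then e p.2 q.2 else (p.2 == q.2) || (p.2 == c q.2)].

Definition double_opp (T : Type) (c : T -> T) (p : bool * T) : bool * T :=
  (~~ p.1, c p.2).

Lemma mem_half (T : finType) (b : bool) (C : {set T}) p :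
  (p \in pair b @: C) = (p.1 == b) && (p.2 \in C).
Proof.
apply/imsetP/andP => [[v vC ->] //|[/eqP <- pC]].
by exists p.2 => //; case: p {pC}.
Qed.

Lemma disjoint_halves (T : finType) (b b' : bool) (C D : {set T}) :
  b != b' -> [disjoint pair b @: C & pair b' @: D].
Proof.
move=> bb; rewrite -setI_eq0; apply/eqP/setP=> p; rewrite in_setI !mem_half inE.
by case: eqP => //= ->; rewrite (negPf bb) andbF.
Qed.

Lemma pair_inj (T : Type) (b : bool) : injective (@pair bool T b).
Proof. by move=> u v []. Qed.

Record opp_graph (T : finType) (e : rel T) (c : T -> T) : Prop := OppGraph {
  opp_sym : symmetric e;
  opp_irr : irreflexive e;
  opp_inv : involutive c;
  opp_adj : forall u v, e (c u) (c v) = e u v;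
  opp_free : forall u, e u (c u) }.

Section Double.
Variables (T : finType) (e : rel T) (c : T -> T).
Hypothesis ec : opp_graph e c.
Let e_sym := opp_sym ec.
Let e_irr := opp_irr ec.
Let cK := opp_inv ec.
Let c_adj := opp_adj ec.
Let c_free := opp_free ec.
Local Notation e2 := (doubling e c).

Lemma double_same b u v : e2 (b, u) (b, v) = e u v.
Proof. by rewrite /doubling /= eqxx. Qed.

Lemma double_cross b u v : e2 (b, u) (~~ b, v) = (u == v) || (u == c v).
Proof. by rewrite /doubling /=; case: b. Qed.

Lemma opp_neq u : c u != u.
Proof. by apply: contraTneq (c_free u) => ->; rewrite e_irr. Qed.

Lemma opp_eqC u v : (u == c v) = (c u == v).
Proof. by rewrite -{1}[u]cK (inj_eq (inv_inj cK)). Qed.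

Lemma double_opp_graph : opp_graph e2 (double_opp c).
Proof.
split=> [[b u] [b' v]|[b u]|[b u]|[b u] [b' v]|[b u]].
- by rewrite /doubling /= eq_sym e_sym [u == v]eq_sym opp_eqC [v == c u]eq_sym.
- by rewrite double_same e_irr.
- by rewrite /double_opp /= negbK cK.
- by rewrite /doubling /= (inj_eq negb_inj) c_adj !(inj_eq (inv_inj cK)).
by rewrite /double_opp /= double_cross cK eqxx orbT.
Qed.

Let e2_sym : symmetric e2 := opp_sym double_opp_graph.

Lemma double_degree d : (forall v, #|[set u | e v u]| = d) ->
  forall p, #|[set q | e2 p q]| = d.+2.
Proof.
move=> deg [b v].
have -> : [set q | e2 (b, v) q] = pair b @: [set u | e v u] :|: [set (~~ b, v); (~~ b, c v)].
  apply/setP=> -[b' u]; rewrite !inE mem_half inE /= /doubling /= !xpair_eqE.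
  by case: b; case: b' => //=; rewrite ?orbF // [v == u]eq_sym opp_eqC [c v == u]eq_sym.
have dis : [disjoint pair b @: [set u | e v u] & [set (~~ b, v); (~~ b, c v)]].
  rewrite disjoint_sym disjoint_setU !disjoints1 !mem_half /=.
  by case: b.
have [_] := leq_card_setU (pair b @: [set u | e v u]) [set (~~ b, v); (~~ b, c v)].
rewrite dis => /eqP ->; rewrite card_imset ?deg; last exact: pair_inj.
by rewrite cards2 xpair_eqE eqxx eq_sym (negPf (opp_neq v)) addn2.
Qed.

Lemma double_connected : connected_in e setT -> connected_in e2 setT.
Proof.
move=> cT; have [/set0Pn[v _] _] := cT.
have cH b : connected_in e2 (pair b @: setT).
  by apply: connected_imset cT => x y; rewrite double_same.
have -> : [set: bool * T] = pair true @: setT :|: pair false @: setT.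
  by apply/setP=> -[[] x]; rewrite !inE !mem_half !inE.
apply: (connectedU e2_sym (cH true) (cH false)) (_ : e2 (true, v) (false, v)).
- by rewrite mem_half inE.
- by rewrite mem_half inE.
by rewrite (double_cross true) eqxx.
Qed.

(** When all terminals lie in one copy, two branches can be added in the other
one: a set containing a vertex or its opposite, for every vertex, is adjacent to
the whole first copy. *)
Lemma packs_one_half b k (Q S : {set T}) :
  connected_in e Q -> connected_in e (~: Q) -> (forall v, (c v \in Q) = (v \notin Q)) ->
  packs e S k -> packs e2 (pair b @: S) k.+2.
Proof.
move=> cQ cQ' cvQ [C [bC dC]].
pose Q2 (a : bool) := if a then Q else ~: Q.
apply: (@branches_packs _ _ _ ('I_k + bool)%type
  (fun i => match i with inl i => pair b @: C i | inr a => pair (~~ b) @: Q2 a end)).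
  split=> [[i|a]|[i|a] [j|a'] ij].
  - have [cC CS adC] := bC i; split.
    + by apply: connected_imset cC => u v; rewrite double_same.
    + apply/subsetP=> p; rewrite inE !mem_half => /andP[/eqP -> pC].
      by have := subsetP CS _ pC; rewrite inE eqxx.
    move=> p; rewrite mem_half => /andP[/eqP pb /adC[u uC su]].
    exists (b, u); first by rewrite mem_half eqxx.
    by case: p pb su => /= _ v -> su; rewrite double_same.
  - split.
    + apply: (@connected_imset _ _ e) => [u v|]; first by rewrite double_same.
      by case: a.
    + apply/subsetP=> p; rewrite inE !mem_half => /andP[/eqP -> _].
      by case: b.
    move=> [b' v]; rewrite mem_half /= => /andP[/eqP -> _].
    have [w wQ vw] : exists2 w, w \in Q2 a & (v == w) || (v == c w).
      have [vQ|vQ] := boolP (v \in Q2 a); first by exists v; rewrite ?eqxx.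
      exists (c v); last by rewrite cK eqxx orbT.
      by move: vQ; rewrite /Q2; case: a; rewrite ?inE cvQ // negbK => ->.
    by exists (~~ b, w); rewrite ?double_cross // mem_half eqxx.
  - rewrite imset_disjoint; last exact: pair_inj.
    by apply: dC; apply: contra ij => /eqP ->.
  - by apply: disjoint_halves; case: (b).
  - by apply: disjoint_halves; case: (b).
  rewrite imset_disjoint; last exact: pair_inj.
  case: a a' ij => -[] //= _; last rewrite disjoint_sym.
    by rewrite disjoints_subset setCK.
  by rewrite disjoints_subset setCK.
by rewrite card_sum card_ord card_bool addn2.
Qed.

End Double.

Section DoubleMixed.
Variables (T : finType) (e : rel T) (c : T -> T) (k : nat).
Hypothesis ec : opp_graph e c.
Hypothesis k_gt2 : 2 < k.
Hypothesis conn : boundary_connected e k.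
Hypothesis deg : forall v, k <= #|[set u | e v u]|.
Let e_sym := opp_sym ec.
Let e_irr := opp_irr ec.
Let cK := opp_inv ec.
Let c_free := opp_free ec.
Local Notation e2 := (doubling e c).
Let e2_sym : symmetric e2 := opp_sym (double_opp_graph ec).

(** Each set [C i] linking [x] to [y] is prolonged, from its vertex [u i], by the
member of the fan from [z] that ends at the neighbour [g (u i)] of [u i] in the
other copy. If this neighbour is [z] itself, [C i] is already adjacent to [z],
and the corresponding member of the fan is empty. *)
Lemma rungs b (x y z : T) (g : T -> T) j (C : 'I_j -> {set T}) (u : 'I_j -> T)
    (F : T -> {set T}) :
  (forall v, e2 (b, v) (~~ b, g v)) ->
  (forall i i', i != i' -> [disjoint C i & C i']) ->
  (forall i, [/\ connected_in e (C i), C i \subset ~: [set x; y],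
       exists2 a, a \in C i & e x a & exists2 a, a \in C i & e y a]) ->
  (forall i, u i \in C i) -> F z = set0 ->
  (forall i, g (u i) != z -> [/\ connected_in e (F (g (u i))), g (u i) \in F (g (u i)),
       F (g (u i)) \subset ~: [set z] & exists2 a, a \in F (g (u i)) & e z a]) ->
  (forall i i', i != i' -> [disjoint F (g (u i)) & F (g (u i'))]) ->
  branches e2 [set (b, x); (b, y); (~~ b, z)]
    (fun i => pair b @: C i :|: pair (~~ b) @: F (g (u i))).
Proof.
move=> hg dC CP uC Fz FP dF; split=> [i|i i' ii']; last first.
  rewrite disjoint_setU ![[disjoint _ & _ :|: _]]disjoint_sym !disjoint_setU.
  rewrite !imset_disjoint; try exact: pair_inj.
  rewrite !disjoint_halves ?(dC i' i) ?(dF i' i) //; try by rewrite eq_sym.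
  1,2: by case: (b).
have [cC Cxy [ax axC xa] [ay ayC ya]] := CP i.
have cCb : connected_in e2 (pair b @: C i).
  by apply: connected_imset cC => v w; rewrite double_same.
have adC : forall s, s \in [set (b, x); (b, y)] ->
    exists2 v, v \in pair b @: C i :|: pair (~~ b) @: F (g (u i)) & e2 s v.
  move=> s; rewrite !inE => /orP[]/eqP->.
    by exists (b, ax); rewrite ?double_same // inE mem_half eqxx axC.
  by exists (b, ay); rewrite ?double_same // inE mem_half eqxx ayC.
have Cb : pair b @: C i \subset ~: [set (b, x); (b, y); (~~ b, z)].
  apply/subsetP=> p; rewrite mem_half => /andP[/eqP pb pC].
  have := subsetP Cxy _ pC; case: p pb {pC} => /= _ v ->.
  by rewrite !inE !xpair_eqE eqxx; case: (b); rewrite /= ?orbF.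
have [gz|/FP[cF gF Fz' [a aF za]]] := eqVneq (g (u i)) z.
  have F0 : pair (~~ b) @: F (g (u i)) = set0 by rewrite gz Fz imset0.
  rewrite F0 setU0 in adC *; split=> // s; rewrite inE => /orP[/adC //|].
  move/set1P->; exists (b, u i); first by rewrite mem_half eqxx uC.
  by rewrite e2_sym -gz hg.
split.
- apply: (connectedU e2_sym cCb _ _ _ (hg (u i))); rewrite ?mem_half ?eqxx ?uC //.
  by apply: connected_imset cF => v w; rewrite double_same.
- rewrite subUset Cb /=; apply/subsetP=> p; rewrite mem_half => /andP[/eqP pb pF].
  have := subsetP Fz' _ pF; case: p pb {pF} => /= _ v ->.
  by rewrite !inE !xpair_eqE eqxx; case: (b); rewrite /= ?orbF.
move=> s; rewrite inE => /orP[/adC //|/set1P->].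
by exists (~~ b, a); rewrite ?double_same // inE !mem_half eqxx aF orbT.
Qed.

Lemma transversal_inj j (C : 'I_j -> {set T}) (u : 'I_j -> T) :
  (forall i i', i != i' -> [disjoint C i & C i']) -> (forall i, u i \in C i) ->
  forall i i', i != i' -> u i != u i'.
Proof.
move=> dC uC i i' /dC/disjointFr H.
by apply: contraTneq (uC i') => <-; rewrite H.
Qed.

Lemma packs_nonadjacent b x y z : x != y -> ~~ e x y ->
  packs e2 [set (b, x); (b, y); (~~ b, z)] k.
Proof.
move=> xy exy; have [|C [dC CP]] := linking_sets e_sym conn deg e_irr _ xy.
  exact: leq_trans k_gt2.
rewrite (negPf exy) subn0 in C dC CP.
have /fin_all_exists[u uC] i : exists a, a \in C i by have [_ _ [a]] := CP i; exists a.
have [||F [Fz FP dF]] := @fan _ _ _ e_sym conn z set0 (u @: 'I_k).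
- by rewrite setC0 subsetT.
- rewrite cards0 addn0 (leq_trans (subset_leq_card (subsetDl _ _))) //.
  by rewrite (leq_trans (leq_imset_card _ _)) // card_ord.
have inj_u := transversal_inj dC uC.
eexists; apply: (@rungs b x y z id _ C u F) => //.
- by move=> v; rewrite double_cross eqxx.
- move=> i ne; have [|cF uF Fz' aF] := FP (u i) _ ne; first exact: imset_f.
  by split=> //; rewrite setU0 in Fz'.
by move=> i i' ii'; apply: dF; rewrite ?imset_f ?inj_u.
Qed.

(** The edge between [x] and [y] leaves only [k.-1] linking sets, so one branch
has to live in the copy of [z]: it consists of the twins [g x] and [g y] and of
a path from [g x] to a neighbour of [z]. One path of the fan from [z] is saved
for it, because a linking set can be assumed to contain the twin of [z]. *)
Lemma packs_adjacent b x y z (g : T -> T) :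
  (forall v, e2 (b, v) (~~ b, g v)) -> involutive g ->
  (forall u v, e (g u) (g v) = e u v) ->
  e x y -> g z \notin [set x; y] ->
  packs e2 [set (b, x); (b, y); (~~ b, z)] k.
Proof.
move=> hg gK g_adj exy gz; have k_gt0 : 0 < k by apply: leq_trans k_gt2.
have xy : x != y by apply: contraTneq exy => ->; rewrite e_irr.
have g_eq u v : (g u == g v) = (u == v) by rewrite (inj_eq (inv_inj gK)).
have [C0 [dC0 CP0]] := linking_sets e_sym conn deg e_irr k_gt0 xy.
rewrite exy subn1 in C0 dC0 CP0.
have k1_gt0 : 0 < k.-1 by case: (k) k_gt2 => [|[|]].
have [i|C [dC CP [i0 i0z]]] := absorb e_sym conn k_gt2 k1_gt0 gz dC0.
  by case: (CP0 i).
(* Choosing [g z] in [C i0] makes [z] one of the targets, whose member of the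
   fan is empty: this makes room for the additional target [g x]. *)
have /fin_all_exists2[u uC uz] i : exists2 a, a \in C i & i = i0 -> a = g z.
  have [->|ne] := eqVneq i i0; first by exists (g z).
  have [[/set0Pn[a aC] _] _ _] := CP i.
  by exists a => // /eqP; rewrite (negPf ne).
have uxy i : (u i != x) && (u i != y).
  by have [_ /subsetP/(_ _ (uC i))] := CP i; rewrite !inE negb_or.
pose B := g x |: [set g (u i) | i : 'I_k.-1].
have gxB : g x \in B by apply: setU11.
have guB i : g (u i) \in B by rewrite inE imset_f ?orbT.
have zB : z \in B by rewrite -[z]gK -(uz i0 erefl).
(* The fan avoids [g y], which is reserved for the last branch. *)
have [||F [Fz FP dF]] := @fan _ _ _ e_sym conn z [set g y] B.
- apply/subsetP=> v; rewrite !inE => /orP[/eqP->|/imsetP[i _ ->]]; rewrite g_eq //.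
  by case/andP: (uxy i).
- rewrite cards1 addn1; have := cardsD1 z B; rewrite zB /= add1n => <-.
  rewrite cardsU1 -[X in _ <= X](prednK k_gt0) -add1n.
  by rewrite leq_add ?leq_b1 // (leq_trans (leq_imset_card _ _)) // card_ord.
have gxz : g x != z.
  by apply: contra gz => /eqP <-; rewrite gK set21.
have [cFx gxFx Fxz [a aF za]] := FP _ gxB gxz.
have Fgy v : v \in B -> g y \notin F v.
  move=> vB; have [->|vz] := eqVneq v z; first by rewrite Fz inE.
  have [_ _ Fv _] := FP v vB vz.
  by apply/negP=> /(subsetP Fv); rewrite !inE eqxx orbT.
have gyz : g y != z.
  by apply: contra gz => /eqP <-; rewrite gK set22.
pose L := F (g x) :|: [set g y].
have inj_u := transversal_inj dC uC.
have := @branches_add _ e2 [set (b, x); (b, y); (~~ b, z)] _ _ (pair (~~ b) @: L)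
  (rungs hg dC _ uC Fz _ _).
rewrite card_ord prednK //; apply.
- move=> i; have [cC Cxy C0C] := CP i; have [_ _ [v vC xv] [w wC yw]] := CP0 i.
  by split=> //; [exists v | exists w] => //; apply: (subsetP C0C).
- move=> i ne; have [cF gF FY ?] := FP _ (guB i) ne; split=> //.
  by rewrite (subset_trans FY) // setCS subsetUl.
- by move=> i i' ii'; apply: dF; rewrite ?guB ?g_eq ?inj_u.
- split.
  + apply: (@connected_imset _ _ e) => [v w|]; first by rewrite double_same.
    apply: (connectedU e_sym cFx (connected_set1 e_sym (g y)) gxFx (set11 _)).
    by rewrite g_adj.
  + apply/subsetP=> p; rewrite mem_half => /andP[/eqP pb pL].
    have pz : p.2 != z.
      move: pL; rewrite inE => /orP[/(subsetP Fxz)|/set1P->//].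
      by rewrite !inE negb_or => /andP[].
    case: p pb pz {pL} => /= _ v -> vz.
    by rewrite !inE !xpair_eqE (negPf vz) andbF orbF; case: (b).
  move=> p; rewrite !inE => /orP[/orP[]|] /eqP->.
  + by exists (~~ b, g x); rewrite ?hg // mem_half eqxx inE gxFx.
  + by exists (~~ b, g y); rewrite ?hg // mem_half eqxx !inE eqxx orbT.
  by exists (~~ b, a); rewrite ?double_same // mem_half eqxx !inE aF.
move=> i; rewrite disjoint_sym disjoint_setU disjoint_halves; last by case: (b).
rewrite imset_disjoint; last exact: pair_inj.
rewrite disjoint_sym disjoint_setU disjoints1 Fgy ?guB // andbT.
by apply: dF; rewrite ?guB // g_eq eq_sym; case/andP: (uxy i).
Qed.

(** The remaining triple, where both twins of [z] are terminals: the opposite of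
[z] is then a common neighbour of all three. *)
Lemma packs_opposite b x : packs e2 [set (b, x); (b, c x); (~~ b, x)] k.
Proof.
have k_gt0 : 0 < k by apply: leq_trans k_gt2.
have xy : x != c x by rewrite eq_sym (opp_neq ec).
have [C [dC CP]] := linking_sets e_sym conn deg e_irr k_gt0 xy.
rewrite c_free subn1 in C dC CP.
have /fin_all_exists[u uC] i : exists a, a \in C i by have [_ _ [a]] := CP i; exists a.
have inj_u := transversal_inj dC uC.
have [||F [Fz FP dF]] := @fan _ _ _ e_sym conn x [set c x] (u @: 'I_k.-1).
- apply/subsetP=> _ /imsetP[i _ ->]; have [_ /subsetP/(_ _ (uC i))] := CP i.
  by rewrite !inE negb_or => /andP[].
- rewrite cards1 addn1 (leq_ltn_trans (subset_leq_card (subsetDl _ _))) //.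
  by rewrite (leq_ltn_trans (leq_imset_card _ _)) // card_ord prednK.
have hid v : e2 (b, v) (~~ b, id v) by rewrite double_cross eqxx.
have := @branches_add _ e2 [set (b, x); (b, c x); (~~ b, x)] _ _ [set (~~ b, c x)]
  (rungs hid dC CP uC Fz _ _).
rewrite card_ord prednK //; apply.
- move=> i ne; have [|cF uF FY ?] := FP _ _ ne; first exact: imset_f.
  by split=> //; rewrite (subset_trans FY) // setCS subsetUl.
- by move=> i i' ii'; apply: dF; rewrite ?imset_f ?inj_u.
- split.
  + exact: (connected_set1 e2_sym).
  + by rewrite sub1set !inE !xpair_eqE (negPf (opp_neq ec x)) !andbF; case: (b).
  move=> p; rewrite !inE => /orP[/orP[]|] /eqP->; exists (~~ b, c x); rewrite ?set11 //.
  + by rewrite double_cross cK eqxx orbT.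
  by rewrite double_same c_free.
move=> i; rewrite disjoints1 inE !mem_half /= negb_or.
apply/andP; split; first by case: (b).
rewrite eqxx /=; have [->|ne] := eqVneq (u i) x; first by rewrite Fz inE.
have [|_ _ FY _] := FP _ _ ne; first exact: imset_f.
by apply/negP=> /(subsetP FY); rewrite !inE eqxx orbT.
Qed.

Lemma packs_two_halves b x y z : x != y ->
  packs e2 [set (b, x); (b, y); (~~ b, z)] k.
Proof.
move=> xy; have [exy|] := boolP (e x y); last exact: packs_nonadjacent.
have [zxy|zxy] := boolP (z \in [set x; y]); last first.
  apply: (@packs_adjacent b x y z id) => // v.
  by rewrite double_cross eqxx.
have [czxy|czxy] := boolP (c z \in [set x; y]); last first.
  apply: (@packs_adjacent b x y z c) => //; last exact: (opp_adj ec).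
  by move=> v; rewrite double_cross cK eqxx orbT.
have cz := opp_neq ec z; move: zxy czxy; rewrite !inE.
case/orP=> /eqP zE /orP[] /eqP czE; move: cz; rewrite zE in czE *.
- by rewrite czE eqxx.
- by rewrite -czE => _; apply: packs_opposite.
- by rewrite -czE (setUC [set (b, c y)]) => _; apply: packs_opposite.
by rewrite czE eqxx.
Qed.

End DoubleMixed.

Lemma cards3_set (T : finType) (S : {set T}) : #|S| = 3 ->
  exists p q r, [/\ p != q, p != r, q != r & S = [set p; q; r]].
Proof.
move=> S3; have /set0Pn[p pS] : S != set0 by rewrite -card_gt0 S3.
have /eqP/cards2P[q [r [qr SE]]] : #|S :\ p| = 2.
  by move: (cardsD1 p S); rewrite pS S3 => -[].
have := setD11 p S; rewrite SE !inE => /negbT; rewrite negb_or => /andP[pq pr].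
by exists p, q, r; split=> //; rewrite -(setD1K pS) SE setUA.
Qed.

Section DoubleStep.
Variables (T : finType) (e : rel T) (c : T -> T) (k : nat).
Hypothesis ec : opp_graph e c.
Local Notation e2 := (doubling e c).
Let e2_sym : symmetric e2 := opp_sym (double_opp_graph ec).

(** Three terminals lie in one copy, or two of them in one copy and the third in
the other. *)
Lemma packs_double (Q : {set T}) :
  2 < k -> boundary_connected e k -> (forall v, k <= #|[set u | e v u]|) ->
  connected_in e Q -> connected_in e (~: Q) -> (forall v, (c v \in Q) = (v \notin Q)) ->
  (forall S : {set T}, #|S| = 3 -> packs e S (k - 2)) ->
  forall S : {set bool * T}, #|S| = 3 -> packs e2 S k.
Proof.
move=> k_gt2 conn deg cQ cQ' cvQ packs3 S S3.
have one_half b : S = pair b @: [set p.2 | p in S] -> packs e2 S k.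
  move=> SE; have S'3 : #|[set p.2 | p in S]| = 3.
    by rewrite -S3 [in RHS]SE [RHS]card_imset //; apply: pair_inj.
  have kE : k = (k - 2).+2 by rewrite -addn2 subnK // ltnW.
  by rewrite SE kE; apply: (packs_one_half ec _ cQ cQ' cvQ (packs3 _ S'3)).
have two b x y z : (b, x) != (b, y) -> packs e2 [set (b, x); (b, y); (~~ b, z)] k.
  rewrite xpair_eqE eqxx /=; exact: (packs_two_halves ec k_gt2 conn deg).
have [p [q [r [pq pr qr SE]]]] := cards3_set S3.
have half : p.1 = q.1 -> p.1 = r.1 -> packs e2 S k.
  move=> pq1 pr1; apply: (one_half p.1); rewrite SE !imsetU !imset_set1.
  by rewrite {2}pq1 {2}pr1 -!surjective_pairing.
case: p q r pq pr qr half SE => [b1 x] [b2 y] [b3 z] pq pr qr half SE.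
have [E12|N12] := eqVneq b1 b2.
  have [E13|N13] := eqVneq b1 b3; first exact: half.
  have N : b3 = ~~ b1 by case: (b1) (b3) N13 => [] [].
  by rewrite SE N -E12; apply: two; rewrite {2}E12.
have [E13|N13] := eqVneq b1 b3.
  have N : b2 = ~~ b1 by case: (b1) (b2) N12 => [] [].
  by rewrite SE N -E13 setUAC; apply: two; rewrite {2}E13.
have N : b1 = ~~ b2 by case: (b1) (b2) N12 => [] [].
have E23 : b3 = b2 by case: (b1) (b2) (b3) N12 N13 => [] [] [].
by rewrite SE N E23 -setUA setUC; apply: two; rewrite -{2}E23.
Qed.

Lemma in_half (A : {set bool * T}) b : (forall p, p \in A -> p.1 = b) ->
  A = pair b @: [set v | (b, v) \in A].
Proof.
move=> Ab; apply/setP=> -[b' v]; rewrite mem_half inE /=.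
by case: eqP => [->|ne] //; apply/negP=> /Ab.
Qed.

Lemma boundary_half b (A : {set T}) :
  boundary e2 (pair b @: A) =
    pair b @: boundary e A :|: pair (~~ b) @: (A :|: c @: A).
Proof.
apply/setP=> -[b' v]; rewrite in_setU !mem_half inE in_setC mem_half /=.
have nbF : (b == ~~ b) = false by case: (b).
have [->|/eqP nb] := eqVneq b' b.
  rewrite nbF /= orbF inE in_setC; congr (_ && _).
  apply/exists_inP/exists_inP => [[[b1 u]]|[u uA uv]].
    by rewrite mem_half => /andP[/eqP /= -> uA]; rewrite double_same; exists u.
  by exists (b, u); rewrite ?mem_half ?eqxx // double_same.
have -> : b' = ~~ b by case: (b') nb; case: (b).
rewrite eqxx /= in_setU; apply/exists_inP/orP => [[[b1 u]]|].
  rewrite mem_half => /andP[/eqP /= -> uA]; rewrite double_cross.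
  case/orP=> /eqP uE; first by left; rewrite -uE.
  by right; apply/imsetP; exists u => //; rewrite uE (opp_inv ec).
case=> [vA|/imsetP[u uA ->]].
  by exists (b, v); rewrite ?mem_half ?eqxx // double_cross eqxx.
by exists (b, u); rewrite ?mem_half ?eqxx // double_cross (opp_inv ec) eqxx orbT.
Qed.

Lemma card_boundary_half b (A : {set T}) :
  #|boundary e2 (pair b @: A)| = #|boundary e A| + #|A :|: c @: A|.
Proof.
rewrite boundary_half.
have [_] := leq_card_setU (pair b @: boundary e A) (pair (~~ b) @: (A :|: c @: A)).
rewrite disjoint_halves => [/eqP->|]; last by case: (b).
by rewrite !card_imset //; apply: pair_inj.
Qed.

Lemma card_setU_boundary (U : finType) (r : rel U) (A : {set U}) :
  #|A :|: boundary r A| = #|A| + #|boundary r A|.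
Proof.
have [_ /esym] := leq_card_setU A (boundary r A).
have -> : [disjoint A & boundary r A].
  by rewrite disjoint_sym disjoints_subset; apply/subsetP=> v; rewrite inE => /andP[].
by move/esym/eqP.
Qed.

(** Let [B] be the set of vertices that [A] does not dominate. If [A] and [B] both
meet both copies, the boundary of [A] has at least [k'] vertices in each copy.
Otherwise [A] or [B] lies in one copy, where its boundary is easily computed;
it does not matter which, because the boundary of [B] is included in that of
[A]. *)
Lemma boundary_connected_double k' :
  boundary_connected e k' -> k <= k'.*2 ->
  (forall A : {set T}, A != set0 -> A :|: boundary e A != setT ->
     k <= #|boundary e A| + #|A :|: c @: A|) ->
  k <= #|T| -> boundary_connected e2 k.
Proof.
move=> conn lek small lekT.
have half b (A : {set bool * T}) : A != set0 -> (forall p, p \in A -> p.1 = b) ->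
    k <= #|boundary e2 A|.
  move=> A0 /in_half; set A' := [set v | _] => AE.
  rewrite AE card_boundary_half; have [AT|] := eqVneq (A' :|: boundary e A') setT.
    apply: leq_trans lekT _; rewrite -cardsT -AT card_setU_boundary addnC leq_add2l.
    by apply/subset_leq_card/subsetUl.
  by apply: small; apply: contraNneq A0; rewrite AE => ->; rewrite imset0.
move=> A A0 AT; pose B := ~: (A :|: boundary e2 A).
have BP p q : p \in B -> e2 p q -> q \notin A.
  rewrite !inE negb_or negb_and negbK => /andP[pA]; rewrite (negPf pA) /=.
  move/exists_inPn => nA pq; apply: contraL pq => /nA; by rewrite e2_sym.
have bdB : boundary e2 B \subset boundary e2 A.
  apply/subsetP=> q; rewrite inE !in_setC negbK.
  by case/andP=> + /exists_inP[p pB pq]; rewrite in_setU (negPf (BP _ _ pB pq)).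
have B0 : B != set0 by rewrite -setCT (inj_eq (@setC_inj _)).
have [/existsP[b /forall_inP Ab]|nA] := boolP [exists b, [forall p in A, p.1 == b]].
  by apply: (half b) => // p /Ab/eqP.
have [/existsP[b /forall_inP Bb]|nB] := boolP [exists b, [forall p in B, p.1 == b]].
  by apply: leq_trans (subset_leq_card bdB); apply: (half b) => // p /Bb/eqP.
pose h b := [set v | (b, v) \in A].
have lower b : k' <= #|boundary e (h b)|.
  have other (X : {set bool * T}) : ~~ [exists b, [forall p in X, p.1 == b]] ->
      exists v, (b, v) \in X.
    move/existsPn/(_ (~~ b))/forall_inPn => [[b' v] pX /= nb]; exists v.
    by case: (b) (b') nb pX => [] [].
  have [v vA] := other A nA; have [w wB] := other B nB.
  apply: conn; first by apply/set0Pn; exists v; rewrite inE.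
  have wh : w \notin h b by move: wB; rewrite !inE negb_or => /andP[].
  apply: contraTneq (in_setT w) => <-; rewrite in_setU (negPf wh) inE in_setC wh /=.
  apply/exists_inPn => u; rewrite inE => uA.
  apply: contraL uA => uw; apply: (BP (b, w)) => //.
  by rewrite e2_sym double_same.
apply: leq_trans lek _; rewrite -addnn.
apply: leq_trans (leq_add (lower true) (lower false)) _.
have sub b : pair b @: boundary e (h b) \subset boundary e2 A.
  apply/subsetP=> -[b' v]; rewrite mem_half /= => /andP[/eqP->].
  rewrite !inE => /andP[-> /exists_inP[u]]; rewrite inE => uA uv /=.
  by apply/exists_inP; exists (b, u) => //; rewrite double_same.
rewrite -(card_imset _ (@pair_inj _ true)) -[X in _ + X](card_imset _ (@pair_inj _ false)).
have [_] := leq_card_setU (pair true @: boundary e (h true)) (pair false @: boundary e (h false)).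
rewrite disjoint_halves // => /eqP <-.
by apply: subset_leq_card; rewrite subUset !sub.
Qed.

End DoubleStep.

(** * Searching for branches in a small graph *)

Section Search.
Variables (T : finType) (e : rel T).

(** Backtracking search for [k] disjoint members of [cs], with [size cs] as fuel.
The nested conditionals here and in [dominates] are lazy under call by value,
whereas a conjunction would evaluate both of its arguments. *)
Fixpoint select fuel k (cs : seq (seq T)) : bool :=
  if k is k'.+1 then
    if fuel is f.+1 then
      if cs is C :: cs' then
        if select f k' (filter (fun D => ~~ has (mem C) D) cs') then true
        else select f k cs'
      else false
    else false
  else true.

Fixpoint couples (V : seq T) : seq (T * T) :=
  if V is u :: V' then map (pair u) V' ++ couples V' else [::].

Fixpoint dominates (S C : seq T) : bool :=
  if S is s :: S' then if has (e s) C then dominates S' C else false else true.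

(** Paths with at most three vertices, each listed in one direction only. *)
Definition short_paths (V : seq T) : seq (seq T) :=
  [seq [:: u] | u <- V] ++
  [seq [:: p.1; p.2] | p <- filter (fun p => e p.1 p.2) (couples V)] ++
  flatten [seq [seq [:: p.1; v; p.2] | p <- couples (filter (e v) V)] | v <- V].

Definition branch_search (V S : seq T) k : bool :=
  let cs := filter (dominates S) (short_paths (filter (fun v => v \notin S) V)) in
  select (size cs) k cs.

Lemma dominatesP S C : reflect {in S, forall s, has (e s) C} (dominates S C).
Proof.
apply: (iffP idP) => [|dS].
  elim: S => //= s S IH; case: ifP => // sC /IH dS t.
  by rewrite inE => /orP[/eqP->|/dS].
elim: S dS => //= s S IH dS; rewrite dS ?mem_head // IH // => t tS.
by apply: dS; rewrite inE tS orbT.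
Qed.

Lemma couplesP V u v : (u, v) \in couples V -> u \in V /\ v \in V.
Proof.
elim: V => //= w V IH; rewrite mem_cat !inE => /orP[/mapP[x xV [-> ->]]|/IH[-> ->]].
  by rewrite eqxx xV orbT.
by rewrite !orbT.
Qed.

Lemma short_pathsP V C : symmetric e -> C \in short_paths V ->
  [/\ C != [::], sorted e C & {subset C <= V}].
Proof.
move=> e_sym.
rewrite !mem_cat => /orP[/mapP[u uV ->]|/orP[/mapP[[u v]]|/flattenP[l /mapP[v vV ->]]]].
- by split=> // w; rewrite inE => /eqP->.
- rewrite mem_filter => /andP[/= uv /couplesP[uV vV]] ->; split; rewrite //= ?uv // => w.
  by rewrite !inE => /orP[] /eqP->.
case/mapP=> -[u w] /couplesP[]; rewrite !mem_filter => /andP[vu uV] /andP[vw wV] -> /=.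
split; rewrite //= ?vw ?(e_sym u) ?vu // => x.
by rewrite !inE => /or3P[] /eqP->.
Qed.

Lemma selectP fuel k cs : select fuel k cs ->
  exists l : seq (seq T), [/\ size l = k, {subset l <= cs}
    & pairwise (fun C D => ~~ has (mem C) D) l].
Proof.
elim: fuel k cs => [|f IH] [|k] [|C cs] //=; try by exists [::].
case: ifP => [/IH[l [sl lcs lp]] _|_ /IH[l [sl lcs lp]]]; last first.
  by exists l; split=> // D /lcs DC; rewrite inE DC orbT.
exists (C :: l); split=> /=; first by rewrite sl.
  by move=> D; rewrite !inE => /predU1P[->|/lcs]; rewrite ?eqxx // mem_filter orbC => /andP[_ ->].
by rewrite lp andbT; apply/allP => D /lcs; rewrite mem_filter => /andP[].
Qed.

Lemma sorted_connected (C : seq T) : symmetric e ->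
  C != [::] -> sorted e C -> connected_in e [set v in C].
Proof.
move=> e_sym; case: C => // a p _ /=.
elim: p a => [|b p IH] a /=.
  move=> _; have -> : [set v in [:: a]] = [set a] by apply/setP=> v; rewrite !inE.
  exact: connected_set1.
case/andP=> ab /IH cp.
have -> : [set v in [:: a, b & p]] = [set a] :|: [set v in b :: p].
  by apply/setP=> v; rewrite !inE.
apply: (connectedU e_sym (connected_set1 e_sym a) cp (set11 a) _ ab).
by rewrite !inE eqxx.
Qed.

Lemma branch_search_packs V S k : symmetric e ->
  branch_search V S k -> packs e [set v in S] k.
Proof.
move=> e_sym /selectP[l [sl lcs lp]].
have nthl i : i < k -> nth [::] l i \in l by rewrite -sl; apply: mem_nth.
exists (fun i : 'I_k => [set v in nth [::] l i]); split=> [i|i j].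
  have := lcs _ (nthl i (ltn_ord i)); rewrite mem_filter.
  case/andP=> /dominatesP adC /(short_pathsP e_sym)[nC sC CV]; split.
  - exact: sorted_connected.
  - by apply/subsetP=> v; rewrite !inE => /CV; rewrite mem_filter => /andP[].
  move=> s; rewrite inE => /adC/hasP[u uC su].
  by exists u; rewrite ?inE.
wlog ij : i j / i < j.
  move=> H ne; move: (ne); rewrite -val_eqE neq_ltn => /orP[ij|ij]; first exact: H.
  by rewrite disjoint_sym; apply: H; rewrite // eq_sym.
move=> _; have /(pairwiseP [::])/(_ i j) := lp.
rewrite !inE sl !ltn_ord => /(_ erefl erefl ij) /hasPn nC.
rewrite -setI_eq0; apply/eqP/setP=> v; rewrite !inE; apply/negP.
by case/andP=> vi /nC; rewrite /= vi.
Qed.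

End Search.

(** * Augmented cubes by repeated doubling *)

(** [cube n] is the vertex set of the augmented cube of dimension [n.+1]. *)
Fixpoint cube n : finType := if n is m.+1 then (bool * cube m)%type else bool.

Fixpoint cube_opp n : cube n -> cube n :=
  if n is m.+1 then double_opp (@cube_opp m) else negb.

Fixpoint cube_adj n : rel (cube n) :=
  if n is m.+1 then doubling (@cube_adj m) (@cube_opp m) else fun x y => x != y.

Lemma cube_opp_graph n : opp_graph (@cube_adj n) (@cube_opp n).
Proof.
elim: n => [|n IHn]; last exact: double_opp_graph.
by split=> [[] []|[]|[]|[] []|[]].
Qed.

Lemma cube_degree n x : #|[set y | @cube_adj n x y]| = n.*2.+1.
Proof.
elim: n x => [|n IHn] x; last by rewrite (double_degree (cube_opp_graph n) IHn).
have -> : [set y | @cube_adj 0 x y] = [set ~~ x].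
  by apply/setP=> y; rewrite !inE; case: x y => [] [].
exact: cards1.
Qed.

Lemma cube_connected n : connected_in (@cube_adj n) setT.
Proof.
elim: n => [|n IHn]; last exact: (double_connected (cube_opp_graph n)).
split=> [|u v _ _]; first by apply/set0Pn; exists true; rewrite inE.
have [->|uv] := eqVneq u v; first exact: connect0.
by apply/connect1/and3P; rewrite !inE.
Qed.

Lemma card_cube n : #|cube n| = 2 ^ n.+1.
Proof. by elim: n => [|n IHn]; rewrite ?card_bool // card_prod card_bool IHn -expnS. Qed.

Lemma cube1_complete (x y : cube 1) : cube_adj x y = (x != y).
Proof. by case: x y => [[] []] [[] []]. Qed.

Lemma cube1_dominated (A : {set cube 1}) : A != set0 ->
  A :|: boundary (@cube_adj 1) A = setT.
Proof.
move=> /set0Pn[a aA]; apply/setP=> v; rewrite in_setU inE in_setC in_setT.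
have [//|vA] := boolP (v \in A); apply/exists_inP; exists a => //.
by rewrite cube1_complete; apply: contraNneq vA => <-.
Qed.

Lemma cube1_boundary_connected k : boundary_connected (@cube_adj 1) k.
Proof. by move=> A /cube1_dominated->; rewrite eqxx. Qed.

Lemma cube2_boundary_connected : boundary_connected (@cube_adj 2) 4.
Proof.
apply: (boundary_connected_double (cube_opp_graph 1) (@cube1_boundary_connected 4)) => //.
  by move=> A /cube1_dominated->; rewrite eqxx.
by rewrite card_cube.
Qed.

(** The copies have connectedness [4] only, instead of [5]. However, a set that
does not dominate such a copy is within one of its two halves, which are
complete, so that the twins of its vertices and the opposites of these twins are
all distinct. *)
Lemma cube3_boundary_connected : boundary_connected (@cube_adj 3) 7.
Proof.
apply: (boundary_connected_double (cube_opp_graph 2) cube2_boundary_connected) => //; last first.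
  by rewrite card_cube.
move=> A A0 nT; have /set0Pn[[b w]] : ~: (A :|: boundary (@cube_adj 2) A) != set0.
  by rewrite -setCT (inj_eq (@setC_inj _)).
rewrite in_setC in_setU inE in_setC negb_or => /andP[wA].
rewrite wA /= => /exists_inPn wN.
have /in_half AE : forall p, p \in A -> p.1 = ~~ b.
  move=> [b' v] pA; have [//|bb] := eqVneq b' (~~ b).
  have {}bb : b' = b by case: (b) b' bb {pA} => [] [].
  have step : @cube_adj 1 v w -> doubling (@cube_adj 1) (@cube_opp 1) (b, v) (b, w).
    by rewrite double_same.
  move: pA; rewrite bb => pA; have /negP nvw := wN _ pA.
  have [vw|vw] := eqVneq v w; first by rewrite -vw pA in wA.
  by case: nvw; apply: step; rewrite cube1_complete.
move: AE; set A1 := [set v | _] => AE.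
have A10 : A1 != set0 by apply: contraNneq A0; rewrite AE => ->; rewrite imset0.
have bd4 : #|A1| + #|boundary (@cube_adj 1) A1| = 4.
  by rewrite -card_setU_boundary cube1_dominated // cardsT; apply: (card_cube 1).
have two : 2 <= #|A1 :|: @cube_opp 1 @: A1|.
  have /set0Pn[v vA] := A10.
  apply: (@leq_trans #|[set v; @cube_opp 1 v]|).
    by rewrite cards2 eq_sym (opp_neq (cube_opp_graph 1)).
  by apply/subset_leq_card; rewrite subUset !sub1set !in_setU vA imset_f ?orbT.
have twins : #|A :|: @cube_opp 2 @: A| = #|A1| + #|A1|.
  have -> : @cube_opp 2 @: A = pair b @: (@cube_opp 1 @: A1).
    rewrite {1}AE -!imset_comp; apply: eq_imset => v /=.
    by rewrite /double_opp negbK.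
  rewrite {1}AE; have [_] := leq_card_setU (pair (~~ b) @: A1) (pair b @: (@cube_opp 1 @: A1)).
  rewrite disjoint_halves => [/eqP->|]; last by case: (b).
  rewrite !card_imset //; try exact: pair_inj.
  exact: inv_inj (opp_inv (cube_opp_graph 1)).
have bdA : #|boundary (@cube_adj 2) A| =
    #|boundary (@cube_adj 1) A1| + #|A1 :|: @cube_opp 1 @: A1|.
  by rewrite {1}AE -(card_boundary_half (cube_opp_graph 1) (~~ b)).
have A1_gt0 : 0 < #|A1| by rewrite card_gt0.
by rewrite twins bdA; lia.
Qed.

Lemma cube_boundary_connected n : 3 <= n -> boundary_connected (@cube_adj n) n.*2.+1.
Proof.
case: n => [|[|[|n]]] // _; elim: n => [|n IHn]; first exact: cube3_boundary_connected.
apply: (boundary_connected_double (cube_opp_graph n.+3) IHn) => [|A A0 nT|].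
- lia.
- have := IHn A A0 nT; suff : 2 <= #|A :|: @cube_opp n.+3 @: A| by lia.
  have /set0Pn[v vA] := A0; apply: (@leq_trans #|[set v; @cube_opp n.+3 v]|).
    by rewrite cards2 eq_sym (opp_neq (cube_opp_graph n.+3)).
  by apply/subset_leq_card; rewrite subUset !sub1set !in_setU vA imset_f ?orbT.
rewrite card_cube; elim: n {IHn} => // n IHn.
by rewrite expnS; lia.
Qed.

(** * Branches in augmented cubes *)

Lemma packs_cube_step n :
  boundary_connected (@cube_adj n.+1) n.*2.+3 ->
  (forall S : {set cube n.+1}, #|S| = 3 -> packs (@cube_adj n.+1) S n.*2.+1) ->
  forall S : {set cube n.+2}, #|S| = 3 -> packs (@cube_adj n.+2) S n.*2.+3.
Proof.
move=> conn packs3.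
have quarter b : connected_in (@cube_adj n.+1) (pair b @: [set: cube n]).
  apply: connected_imset (cube_connected n) => u v uv.
  by rewrite /= double_same.
have qC b : ~: (pair b @: [set: cube n]) = pair (~~ b) @: [set: cube n].
  apply/setP=> p; rewrite in_setC !mem_half !inE !andbT.
  by case: p.1 b => [] [].
apply: (packs_double (cube_opp_graph n.+1) (Q := pair true @: [set: cube n])) => //.
- by move=> v; rewrite cube_degree doubleS.
- by rewrite qC.
- by move=> v; rewrite !mem_half !inE !andbT; case: v => [] [].
Qed.

Lemma packs_cube1 (S : {set cube 1}) : #|S| = 3 -> packs (@cube_adj 1) S 1.
Proof.
move=> S3; have [v vS] : exists v, v \notin S.
  have /set0Pn[v] : ~: S != set0 by rewrite -card_gt0 cardsCs setCK S3 (card_cube 1).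
  by rewrite inE; exists v.
exists (fun=> [set v]); split=> [_|i j]; last by rewrite !ord1.
split; first exact: (connected_set1 (opp_sym (cube_opp_graph 1))).
  by rewrite sub1set inE.
move=> s sS; exists v; first exact: set11.
by rewrite cube1_complete; apply: contraNneq vS => <-.
Qed.

Fixpoint cube_trans n : cube n -> cube n -> cube n :=
  if n is m.+1 then fun a x => (a.1 (+) x.1, cube_trans a.2 x.2) else addb.

Fixpoint cube_zero n : cube n := if n is m.+1 then (false, cube_zero m) else false.

Lemma cube_transK n (a : cube n) : involutive (cube_trans a).
Proof.
elim: n a => [|n IHn] a x; first exact: addKb.
by case: x => b x /=; rewrite addKb IHn.
Qed.

Lemma cube_trans_self n (a : cube n) : cube_trans a a = cube_zero n.
Proof. by elim: n a => [|n IHn] a /=; rewrite addbb ?IHn. Qed.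

Lemma cube_trans_opp n (a x : cube n) :
  cube_trans a (cube_opp x) = cube_opp (cube_trans a x).
Proof.
elim: n a x => [|n IHn] a x /=; first exact: addbN.
by rewrite /double_opp /= addbN IHn.
Qed.

Lemma cube_trans_adj n (a x y : cube n) :
  cube_adj (cube_trans a x) (cube_trans a y) = cube_adj x y.
Proof.
elim: n a x y => [|n IHn] a x y; first by rewrite /= (inj_eq (@addbI a)).
rewrite /= /doubling /= (inj_eq (@addbI _)) IHn -cube_trans_opp.
by rewrite !(inj_eq (inv_inj (@cube_transK _ _))).
Qed.

Definition cube3_nonzero : seq (cube 3) :=
  let B := [:: false; true] in
  behead [seq (a, p) | a <- B, p <- [seq (b, q) | b <- B, q <- [seq (c, d) | c <- B, d <- B]]].

Lemma mem_cube3_nonzero v : v != cube_zero 3 -> v \in cube3_nonzero.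
Proof. by case: v => [[] [[] [[] []]]]. Qed.

(** In dimension 4, a translation reduces the problem to triples that contain the
vertex zero; for each of them five disjoint branches can be found among the
paths with at most three vertices. *)
Lemma cube3_search : pairwise
  (fun y z => branch_search (@cube_adj 3) cube3_nonzero [:: cube_zero 3; y; z] 5) cube3_nonzero.
Proof. by vm_compute. Qed.

Lemma pairwise_or (T : eqType) (r : rel T) (s : seq T) x y :
  pairwise r s -> x \in s -> y \in s -> x != y -> r x y || r y x.
Proof.
elim: s => //= z s IH /andP[/allP zs ps]; rewrite !inE.
case/predU1P=> [->|xs] /predU1P[->|ys] xy; first by rewrite eqxx in xy.
- by rewrite zs.
- by rewrite zs ?orbT.
exact: IH.
Qed.

Lemma packs_cube3_zero y z : y != cube_zero 3 -> z != cube_zero 3 -> y != z ->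
  packs (@cube_adj 3) [set cube_zero 3; y; z] 5.
Proof.
move=> /mem_cube3_nonzero yV /mem_cube3_nonzero zV yz.
have set3 (u v w : cube 3) : [set x in [:: u; v; w]] = [set u; v; w].
  by apply/setP=> x; rewrite !inE orbA.
case/orP: (pairwise_or cube3_search yV zV yz);
  move/(branch_search_packs (opp_sym (cube_opp_graph 3))).
  by rewrite set3.
by rewrite set3 setUAC.
Qed.

Lemma packs_cube3 (S : {set cube 3}) : #|S| = 3 -> packs (@cube_adj 3) S 5.
Proof.
move=> S3; have [p [q [r [pq pr qr SE]]]] := cards3_set S3.
have t_inj := inv_inj (@cube_transK 3 p).
have {SE} -> : S = cube_trans p @: [set cube_zero 3; cube_trans p q; cube_trans p r].
  rewrite !imsetU !imset_set1 !cube_transK -(cube_trans_self p) cube_transK.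
  exact: SE.
apply: (packs_iso t_inj (cube_trans_adj p)); apply: packs_cube3_zero.
- by rewrite -(cube_trans_self p) (inj_eq t_inj) eq_sym.
- by rewrite -(cube_trans_self p) (inj_eq t_inj) eq_sym.
by rewrite (inj_eq t_inj).
Qed.

Lemma packs_cube n (S : {set cube n.+1}) : #|S| = 3 -> packs (@cube_adj n.+1) S n.*2.+1.
Proof.
elim: n S => [|[|[|n]] IHn] S S3.
- exact: packs_cube1.
- exact: (packs_cube_step (@cube1_boundary_connected 3) IHn).
- exact: packs_cube3.
exact: (packs_cube_step (@cube_boundary_connected n.+3 _) IHn).
Qed.

(** * From branches to pendant Steiner trees *)

Section Trees.
Variable G : sgraph.
Implicit Types (S C V : {set G}) (E : {set {set G}}) (T : subgr G).

Lemma sadj_sym T : symmetric (sadj T).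
Proof. by move=> u v; rewrite /sadj /= setUC. Qed.

Lemma sconnected_root T a : a \in sverts T ->
  (forall v, v \in sverts T -> connect (sadj T) a v) -> sconnected T.
Proof.
move=> aV toV; apply/andP; split; first by apply/set0Pn; exists a.
apply/forall_inP => u uV; apply/forall_inP => v vV.
by rewrite (connect_trans _ (toV v vV)) // sym_connect_sym ?toV //; apply: sadj_sym.
Qed.

Lemma tree_set1 (a : G) : is_tree ([set a], set0 : {set {set G}}).
Proof.
apply/and3P; split.
- by rewrite /is_subgraph sub0set; apply/forall_inP => e; rewrite inE.
- by apply: (@sconnected_root _ a) => [|v]; rewrite /= inE // => /eqP->; apply: connect0.
apply/sacyclicP => -[|u [|v c]] //= _ /andP[/=].
by rewrite /sadj /= inE.
Qed.

Lemma tree_edge_sub V E (e : {set G}) : is_tree (V, E) -> e \in E -> e \subset V.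
Proof. by case/and3P=> /andP[_ /forall_inP eV] _ _ /eV. Qed.

(** A cycle through the new leaf [w] would have [v] on both sides of [w]. *)
Lemma tree_add_leaf V E v w : is_tree (V, E) -> v \in V -> w \notin V -> adj v w ->
  is_tree (w |: V, [set v; w] |: E).
Proof.
move=> treeVE vV wV vw; have EV := tree_edge_sub treeVE.
have [/andP[/subsetP EG _] /andP[_ /forall_inP conn] /sacyclicP acyc] := and3P treeVE.
set T := (w |: V, _).
have TE u1 u2 : sadj T u1 u2 -> (u1 == w) || (u2 == w) || sadj (V, E) u1 u2.
  rewrite /sadj /= !inE => /orP[/eqP E12|->]; last by rewrite orbT.
  by have := set22 v w; rewrite -E12 !inE ![w == _]eq_sym => ->.
have Tw u : sadj T w u -> u = v.
  rewrite /sadj /= !inE => /orP[/eqP E12|/EV/subsetP/(_ w (set21 _ _))].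
    have := set22 w u; rewrite E12 !inE => /orP[/eqP//|/eqP uw].
    have := set21 v w; rewrite -E12 uw !inE orbb => /eqP vw'.
    by rewrite vw' in vV; rewrite vV in wV.
  by rewrite (negPf wV).
apply/and3P; split.
- apply/andP; split; last apply/forall_inP.
    apply/subsetP=> e; rewrite !inE => /orP[/eqP->|/EG //].
    by apply/imsetP; exists (v, w); rewrite ?inE.
  move=> e; rewrite !inE => /orP[/eqP->|/EV eV].
    by rewrite subUset !sub1set !inE vV eqxx orbT.
  exact: subset_trans eV (subsetUr _ _).
- apply: (@sconnected_root _ v) => [|u]; rewrite /= !inE ?vV ?orbT // => /orP[/eqP->|uV].
    by apply: connect1; apply: setU11.
  have := forall_inP (conn v vV) u uV; apply: connect_mono => a b.
  exact: setU1r.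
apply/sacyclicP => c c_gt2 /andP[cyc Uc].
have [wc|wc] := boolP (w \in c).
  have [i c' rotE] := rot_to wc; rewrite -(rot_cycle i) rotE /= in cyc.
  rewrite -(rot_uniq i) rotE in Uc; rewrite -(size_rot i) rotE in c_gt2.
  case: c' rotE c_gt2 cyc Uc => [|a [|b c']] //= _ _ /andP[/Tw -> /andP[_ cyc]] /and3P[_ vc _].
  have : sadj T w (last b c').
    by move: cyc; rewrite rcons_path sadj_sym => /andP[].
  by move/Tw => lv; case/negP: vc; rewrite -lv mem_last.
apply: (acyc c c_gt2); rewrite /ucycle Uc andbT.
apply: (sub_in_cycle (P := mem c)) cyc => [a b|]; last by apply/allP.
move=> ac bc /TE; rewrite -orbA => /or3P[/eqP aw|/eqP bw|//].
  by rewrite -aw ac in wc.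
by rewrite -bw bc in wc.
Qed.

(** A tree inside [C] that does not span [C] can be extended by a leaf. *)
Lemma spanning_tree C : connected_in (@adj G) C -> exists E, is_tree (C, E).
Proof.
case=> /set0Pn[a aC] cC.
suff grow m V E : #|C :\: V| <= m -> is_tree (V, E) -> a \in V -> V \subset C ->
    exists E, is_tree (C, E).
  by apply: (grow _ [set a] set0 (leqnn _) (tree_set1 a)); rewrite ?set11 ?sub1set.
elim: m V E => [|m IH] V E leVm treeV aV VC.
  move: leVm; rewrite leqn0 cards_eq0 setD_eq0 => CV; exists E.
  by have -> : C = V by apply/eqP; rewrite eqEsubset CV.
have [CV|/subsetPn[b bC bV]] := boolP (C \subset V).
  by exists E; have -> : C = V by apply/eqP; rewrite eqEsubset CV.
have [/exists_inP[u uV /exists_inP[w]]|none] :=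
    boolP [exists u in V, exists w in C :\: V, adj u w].
  rewrite inE => /andP[wV wC] uw; apply: (IH (w |: V)).
  - have := cardsD1 w (C :\: V); rewrite !inE wV wC add1n => le.
    by rewrite setUC -setDDl -ltnS -le.
  - exact: tree_add_leaf treeV uV wV uw.
  - by rewrite inE aV orbT.
  by rewrite subUset sub1set wC.
have clV : closed (rin (@adj G) C) (mem V).
  apply: intro_closed => [|u w /and3P[uw uC wC] uV].
    by move=> u v; rewrite rin_connect_sym //; apply: adj_sym.
  apply: contraR none => wV; apply/exists_inP; exists u => //.
  by apply/exists_inP; exists w => //; rewrite inE wV.
by have := closed_connect clV (cC a b aC bC); rewrite /= aV (negPf bV).
Qed.

(** The terminals are attached as leaves to a spanning tree of the branch. *)
Lemma pendant_tree_of_branch S C : branch (@adj G) S C ->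
  exists E, pendant_tree S (S :|: C, E).
Proof.
case=> cC CS adC.
suff attach (l : seq G) : uniq l -> {subset l <= S} ->
    exists E, is_tree ([set v in l] :|: C, E) /\
      {in l, forall s, sdeg ([set v in l] :|: C, E) s = 1}.
  have [||E [treeE degE]] := attach (enum S); first exact: enum_uniq.
    by move=> v; rewrite mem_enum.
  have SE : [set v in enum S] = S by apply/setP=> v; rewrite inE mem_enum.
  rewrite SE in treeE degE; exists E; apply/andP; split.
    by rewrite /steiner_tree treeE subsetUl.
  by apply/forall_inP => s sS; rewrite degE // mem_enum.
elim: l => [_ _|s l IH /= /andP[sl Ul] slS].
  have [E treeE] := spanning_tree cC; exists E; split=> //.
  have -> : [set v in [::]] = set0 :> {set G} by apply/setP=> v; rewrite !inE.
  by rewrite set0U.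
have [|E [treeE degE]] := IH Ul; first by move=> v vl; apply: slS; rewrite inE vl orbT.
have sS : s \in S by apply: slS; rewrite mem_head.
have notC t : t \in S -> t \notin C by apply: contraL => /(subsetP CS); rewrite inE.
have [v vC sv] := adC s sS; set V := _ :|: C in treeE degE.
have sV : s \notin V by rewrite !inE negb_or sl notC.
have VE : [set u in s :: l] :|: C = s |: V.
  by apply/setP=> u; rewrite !inE orbA.
exists ([set v; s] |: E); rewrite VE; split.
  by apply: tree_add_leaf => //; rewrite ?inE ?vC ?orbT // adj_sym.
move=> t; rewrite inE => /predU1P[->|tl].
  rewrite /sdeg /= (_ : [set e in _ | _] = [set [set v; s]]) ?cards1 //.
  apply/setP=> e; rewrite !inE; case: eqP => [->|_] /=; first by rewrite set22.
  by apply: contraNF sV => /andP[/(tree_edge_sub treeE)/subsetP eV /eV].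
rewrite -(degE t tl) /sdeg /=; apply: eq_card => e; rewrite !inE.
case: eqP => [->|_] //=; rewrite !inE.
have tS : t \in S by apply: slS; rewrite inE tl orbT.
have -> : (t == v) = false by apply: contraTF vC => /eqP <-; apply: notC.
have -> : (t == s) = false by apply: contraNF sl => /eqP <-.
by rewrite /= andbF.
Qed.

(** In a pendant tree with at least three terminals, an edge between two
terminals would be a connected component by itself. *)
Lemma pendant_tree_edge S T (e : {set G}) : 2 < #|S| -> pendant_tree S T ->
  e \in sedges T -> ~~ (e \subset S).
Proof.
move=> S_gt2 /andP[/andP[/and3P[/andP[/subsetP EG _] + _] ST] /forall_inP degS] eT.
case/andP=> _ /forall_inP conn.
have /imsetP[[x y] /=] := EG e eT; rewrite inE /= => xy eE; apply/negP=> eS.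
have aS a : a \in e -> a \in S by move/(subsetP eS).
have xe : x \in e by rewrite eE set21.
have [z zS ze] : exists2 z, z \in S & z \notin e.
  apply/subsetPn/negP => /subset_leq_card; rewrite leqNgt (leq_ltn_trans _ S_gt2) //.
  by rewrite eE cards2; case: eqP.
have cl : closed (sadj T) (mem e).
  apply: intro_closed => [|u w uw ue]; first exact/sym_connect_sym/sadj_sym.
  have /cards1P[d dE] := degS u (aS u ue).
  have : e \in [set d] by rewrite -dE inE eT.
  have : [set u; w] \in [set d] by rewrite -dE inE set21 andbT.
  by rewrite !inE => /eqP <- /eqP ->; apply: set22.
have xV := subsetP ST x (aS x xe); have zV := subsetP ST z zS.
by have := closed_connect cl (forall_inP (conn x xV) z zV); rewrite /= xe (negPf ze).
Qed.

Lemma packs_local S k : 2 < #|S| -> packs (@adj G) S k -> k <= local_pendant_conn S.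
Proof.
move=> S_gt2 [C [bC dC]].
have /fin_all_exists[E EP] i := pendant_tree_of_branch (bC i).
pose T i : subgr G := (S :|: C i, E i).
have disj i j : i != j -> int_disjoint S (T i) (T j).
  move=> ij; have VV : sverts (T i) :&: sverts (T j) = S.
    by rewrite /= -setUIr (disjoint_setI0 (dC i j ij)) setU0.
  apply/andP; split; last by rewrite VV.
  apply/eqP/setP=> e; rewrite !inE; apply/negP=> /andP[ei ej].
  have eV l : e \in E l -> e \subset S :|: C l.
    by apply: tree_edge_sub; case/andP: (EP l) => /andP[].
  by have /negP[] := pendant_tree_edge S_gt2 (EP i) ei; rewrite -VV subsetI !eV.
have Tinj : injective T.
  move=> i j Tij; apply/eqP; apply: contraT => /dC/disjoint_setI0.
  have [[/set0Pn[v vC] _] CS _] := bC i.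
  have : v \in sverts (T j) by rewrite -Tij !inE vC orbT.
  have /negPf vS : v \notin S by have := subsetP CS v vC; rewrite inE.
  by rewrite !inE vS /= => vCj /setP/(_ v); rewrite !inE vC vCj.
have <- : #|T @: 'I_k| = k by rewrite card_imset ?card_ord.
apply: (@leq_bigmax_cond _ (pendant_packing S) (fun F : {set subgr G} => #|F|)).
apply/andP; split; first by apply/forall_inP => _ /imsetP[i _ ->]; apply: EP.
apply/forall_inP => _ /imsetP[i _ ->]; apply/forall_inP => _ /imsetP[j _ ->].
by apply/implyP; rewrite (inj_eq Tinj); apply: disj.
Qed.

(** Pendant trees use distinct edges at [x], and none of them leads to [y] or to
[z]. *)
Lemma local_pendant_triangle (x y z : G) : uniq [:: x; y; z] -> adj x y -> adj x z ->
  local_pendant_conn [set x; y; z] <= #|[set v | adj x v]| - 2.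
Proof.
rewrite /= !inE negb_or andbT => /andP[/andP[xny xnz] yz] xy xz.
set S := [set x; y; z]; set D := [set v | adj x v] :\: [set y; z].
have cD : #|D| = #|[set v | adj x v]| - 2.
  by rewrite cardsDS ?cards2 ?yz // subUset !sub1set !inE xy xz.
have S_gt2 : 2 < #|S| by rewrite /S setUC cardsU1 cards2 !inE negb_or ![z == _]eq_sym xnz yz xny.
apply/bigmax_leqP => F /andP[/forall_inP pF /forall_inP dF].
have ex T : exists v, T \in F -> v \in D /\ [set x; v] \in sedges T.
  have [TF|] := boolP (T \in F); last by exists x.
  have pT := pF T TF; have xS : x \in S by rewrite !inE eqxx.
  have /andP[/andP[/and3P[/andP[/subsetP EG _] _ _] _] /forall_inP deg] := pT.
  have /cards1P[e eE] := deg x xS.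
  have /andP[eT xe] : (e \in sedges T) && (x \in e) by have := set11 e; rewrite -eE inE.
  have [v xv ev] : exists2 v, adj x v & e = [set x; v].
    have /imsetP[[u w]] := EG e eT; rewrite inE /= => uw eu.
    move: xe; rewrite eu !inE => /orP[]/eqP->; first by exists w.
    by exists u; rewrite 1?adj_sym // setUC.
  exists v => _; rewrite -ev; split=> //; rewrite inE inE xv andbT.
  have := pendant_tree_edge S_gt2 pT eT; apply: contra => vyz.
  by rewrite ev subUset !sub1set xS !inE; move: vyz; rewrite !inE -orbA => ->; rewrite orbT.
have /fin_all_exists[f fP] := ex.
rewrite -cD -(@card_in_imset _ _ f).
  by apply/subset_leq_card/subsetP=> _ /imsetP[T /fP[? _] ->].
move=> T T' TF TF' fT; apply/eqP; apply: contraT => ne.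
have /implyP/(_ ne)/andP[/eqP E0 _] := forall_inP (dF T TF) T' TF'.
have [_ e1] := fP T TF; have [_ e2] := fP T' TF'.
by have := in_set0 [set x; f T]; rewrite -E0 inE e1 fT e2.
Qed.

End Trees.

(** * The augmented cube as an iterated doubling *)

Fixpoint cube_tuple n : cube n -> n.+1.-tuple bool :=
  if n is m.+1 return cube n -> n.+1.-tuple bool
  then fun p => [tuple of p.1 :: cube_tuple p.2] else fun b => [tuple b].

Lemma cube_tuple_inj n : injective (@cube_tuple n).
Proof.
elim: n => [|n IHn] p q; first by case/(congr1 val).
by case/(congr1 val) => E1 /val_inj/IHn; case: p q E1 => [? ?] [? ?] /= -> ->.
Qed.

Lemma cube_tuple_opp n (p : cube n) :
  cube_tuple (cube_opp p) = map negb (cube_tuple p) :> seq bool.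
Proof. by elim: n p => //= n IHn p; rewrite IHn. Qed.

(** The doubling of [cube] and the recursion of [augcube_adj] are the same, the
first component of a pair being the prefixed bit. *)
Lemma cube_tuple_adj n (p q : cube n) :
  @adj (AQ n.+1) (cube_tuple p) (cube_tuple q) = cube_adj p q.
Proof.
rewrite /=; elim: n p q => [|n IHn] p q; first by rewrite /= -val_eqE /= eqseq_cons andbT.
have bE b (t : n.+1.-tuple bool) : [tuple of behead [tuple of b :: t]] = t by apply: val_inj.
rewrite [LHS]/= !theadE !bE IHn [RHS]/= /doubling /=; case: ifP => // _.
rewrite (inj_eq (@cube_tuple_inj n)) -cube_tuple_opp; congr (_ || _).
exact: (inj_eq (@cube_tuple_inj n)).
Qed.

Lemma cube_tuple_bij n : bijective (@cube_tuple n).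
Proof.
apply: (inj_card_bij (@cube_tuple_inj n)).
by rewrite card_tuple card_bool card_cube.
Qed.

Theorem theorem3p4 (n : nat) (hn : 3 <= n) :
  pendant_conn (AQ n) 3 = 2 * n - 3.
Proof.
case: n hn => [|[|n]] // _.
have inj_t := @cube_tuple_inj n.+1.
have [g gK tK] := cube_tuple_bij n.+1.
apply/eqP; rewrite eqn_leq; apply/andP; split.
  (* A vertex, its twin and the opposite of its twin form a triangle. *)
  pose v := cube_zero n.
  pose x : AQ n.+2 := @cube_tuple n.+1 (true, v).
  pose y : AQ n.+2 := @cube_tuple n.+1 (false, v).
  pose z : AQ n.+2 := @cube_tuple n.+1 (false, cube_opp v).
  have vo : v != cube_opp v by rewrite eq_sym (opp_neq (cube_opp_graph n)).
  have Uxyz : uniq [:: x; y; z].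
    by rewrite (map_inj_uniq inj_t [:: (true, v); (false, v); (false, cube_opp v)])
      /= !inE !xpair_eqE /= vo.
  have xy : adj x y by rewrite cube_tuple_adj; apply/orP; left.
  have xz : adj x z.
    rewrite cube_tuple_adj; apply/orP; right.
    by rewrite /= (opp_inv (cube_opp_graph n)).
  have S3 : #|[set x; y; z]| = 3.
    have -> : [set x; y; z] = [set u in [:: x; y; z]] by apply/setP=> u; rewrite !inE orbA.
    by rewrite cardsE; apply/card_uniqP.
  have degx : #|[set u | adj x u]| = n.+1.*2.+1.
    rewrite -(cube_degree (n := n.+1) (true, v)) -(card_imset _ inj_t).
    apply: eq_card => u; rewrite -[u]tK mem_imset // !inE.
    by rewrite -cube_tuple_adj.
  apply: leq_trans (pendant_conn_le S3) _.
  by apply: leq_trans (local_pendant_triangle Uxyz xy xz) _; rewrite degx; lia.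
have [|S S3 ->] := @pendant_conn_attained (AQ n.+2) 3.
  by rewrite card_tuple card_bool !expnS; have := expn_gt0 2 n; lia.
have SE : S = @cube_tuple n.+1 @: (g @: S).
  by rewrite -imset_comp (eq_imset _ tK) imset_id.
have gS3 : #|g @: S| = 3 by rewrite card_imset //; apply: can_inj tK.
apply: packs_local; first by rewrite S3.
have -> : 2 * n.+2 - 3 = n.*2.+1 by lia.
rewrite SE; apply: packs_iso inj_t _ (packs_cube gS3).
exact: cube_tuple_adj.
Qed.
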